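(* Let $k$ be a field and let $Q$ be a finite quiver with incidence matrix $C$. For $m\ge 1$ let $Q^{(m)}$ be the quiver with incidence matrix $C^m$; i.e., $Q^{(m)}$ has the same vertices as $Q$ and the arrows in $Q^{(m)}$ are the paths of length $m$ in $Q$. Then there is an equivalence of categories $$\mathsf{QGr}(kQ)\equiv\mathsf{QGr}(kQ^{(m)}).$$
   Context: Quivers are finite directed graphs, with loops and multiple arrows allowed. The incidence matrix of $Q$ is $C=(c_{ij})$ indexed by vertices, with $c_{ij}$ the number of arrows from $j$ to $i$. The path algebra $kQ$ (with $pq$ denoting the path $q$ followed by the path $p$) is $\mathbb{N}$-graded by path length; likewise $kQ^{(m)}$ is graded by the length of paths in $Q^{(m)}$. $\mathsf{Gr}(kQ)$ is the category of $\mathbb{Z}$-graded left $kQ$-modules with degree-preserving homomorphisms, $\mathsf{Fdim}(kQ)$ its full localizing subcategory of modules that are the sum of their finite-dimensional submodules, and $\mathsf{QGr}(kQ)=\mathsf{Gr}(kQ)/\mathsf{Fdim}(kQ)$. *)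

(* Defs.v *)
From HB Require Import structures.
From mathcomp Require Import all_boot all_order all_algebra.
From mathcomp Require Import finmap.
From mathcomp.multinomials Require Import monalg.

Set Implicit Arguments.
Unset Strict Implicit.
Unset Printing Implicit Defensive.

Import GRing.Theory.
Local Open Scope ring_scope.

(* ------------------------------------------------------------------------ *)
(* Categories. Hom-sets are setoids: [heq] is equality of morphisms.         *)
(* ------------------------------------------------------------------------ *)

Record category := Category {
  ob :> Type;
  hom : ob -> ob -> Type;
  heq : forall a b, hom a b -> hom a b -> Prop;
  idm : forall a, hom a a;
  comp : forall a b c, hom b c -> hom a b -> hom a c;
  heq_refl : forall a b (f : hom a b), heq f f;
  heq_sym : forall a b (f g : hom a b), heq f g -> heq g f;
  heq_trans : forall a b (f g h : hom a b), heq f g -> heq g h -> heq f h;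
  comp_heq : forall a b c (g g' : hom b c) (f f' : hom a b),
    heq g g' -> heq f f' -> heq (comp g f) (comp g' f');
  comp_assoc : forall a b c d (h : hom c d) (g : hom b c) (f : hom a b),
    heq (comp h (comp g f)) (comp (comp h g) f);
  comp_idl : forall a b (f : hom a b), heq (comp (idm b) f) f;
  comp_idr : forall a b (f : hom a b), heq (comp f (idm a)) f
}.

Arguments idm {_} _.

Record functor (C D : category) := Functor {
  fob :> C -> D;
  fmor : forall a b : C, hom a b -> hom (fob a) (fob b);
  fmor_heq : forall (a b : C) (f g : hom a b), heq f g -> heq (fmor f) (fmor g);
  fmor_id : forall a : C, heq (fmor (idm a)) (idm (fob a));
  fmor_comp : forall (a b c : C) (g : hom b c) (f : hom a b),
    heq (fmor (comp g f)) (comp (fmor g) (fmor f))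
}.

Definition id_functor (C : category) : functor C C.
Proof.
exists (fun a => a) (fun a b f => f) => //; by move=> *; apply: heq_refl.
Defined.

Definition comp_functor (C D E : category) (G : functor D E) (F : functor C D) :
  functor C E.
Proof.
exists (fun a => G (F a)) (fun a b f => fmor G (fmor F f)).
- by move=> a b f g fg; apply/fmor_heq/fmor_heq.
- by move=> a; apply: heq_trans (fmor_id _ _); apply/fmor_heq/fmor_id.
- by move=> a b c g f; apply: heq_trans (fmor_comp _ _ _);
     apply/fmor_heq/fmor_comp.
Defined.

Definition inverse_pair (C : category) (a b : C) (f : hom a b) (g : hom b a) :=
  heq (comp g f) (idm a) /\ heq (comp f g) (idm b).

Record nat_iso (C D : category) (F G : functor C D) := NatIso {
  ni : forall a : C, hom (F a) (G a);
  ni_inv : forall a : C, hom (G a) (F a);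
  ni_pair : forall a : C, inverse_pair (ni a) (ni_inv a);
  ni_natural : forall (a b : C) (f : hom a b),
    heq (comp (ni b) (fmor F f)) (comp (fmor G f) (ni a))
}.

Definition equivalent_categories (C D : category) : Prop :=
  exists (F : functor C D) (G : functor D C),
    inhabited (nat_iso (comp_functor G F) (id_functor C)) /\
    inhabited (nat_iso (comp_functor F G) (id_functor D)).

(* ------------------------------------------------------------------------ *)
(* Localization C[W^-1] of a category at a class W of morphisms (Gabriel and *)
(* Zisman): morphisms are formal composites of morphisms of C and of formal  *)
(* inverses of elements of W, modulo the least congruence for which the      *)
(* result is a category, C -> C[W^-1] is a functor, and the formal inverses  *)
(* are inverses. [loc_lift] and [loc_lift_unique] are its universal          *)
(* property.                                                                 *)
(* ------------------------------------------------------------------------ *)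

Section Localization.
Variables (C : category) (W : forall a b : C, hom a b -> Prop).

Inductive lhom : C -> C -> Type :=
| LId a : lhom a a
| LMor a b of hom a b : lhom a b
| LInv a b (w : hom a b) of W w : lhom b a
| LComp a b c of lhom b c & lhom a b : lhom a c.

Inductive leq_lhom : forall a b, lhom a b -> lhom a b -> Prop :=
| LRefl a b (f : lhom a b) : leq_lhom f f
| LSym a b (f g : lhom a b) : leq_lhom f g -> leq_lhom g f
| LTrans a b (f g h : lhom a b) :
    leq_lhom f g -> leq_lhom g h -> leq_lhom f h
| LCompCong a b c (g g' : lhom b c) (f f' : lhom a b) :
    leq_lhom g g' -> leq_lhom f f' -> leq_lhom (LComp g f) (LComp g' f')
| LAssoc a b c d (h : lhom c d) (g : lhom b c) (f : lhom a b) :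
    leq_lhom (LComp h (LComp g f)) (LComp (LComp h g) f)
| LIdl a b (f : lhom a b) : leq_lhom (LComp (LId b) f) f
| LIdr a b (f : lhom a b) : leq_lhom (LComp f (LId a)) f
| LMorHeq a b (f g : hom a b) : heq f g -> leq_lhom (LMor f) (LMor g)
| LMorId a : leq_lhom (LMor (idm a)) (LId a)
| LMorComp a b c (g : hom b c) (f : hom a b) :
    leq_lhom (LMor (comp g f)) (LComp (LMor g) (LMor f))
| LInvl a b (w : hom a b) (Ww : W w) :
    leq_lhom (LComp (LInv Ww) (LMor w)) (LId a)
| LInvr a b (w : hom a b) (Ww : W w) :
    leq_lhom (LComp (LMor w) (LInv Ww)) (LId b).

Definition localization : category :=
  Category LRefl LSym LTrans LCompCong LAssoc LIdl LIdr.

Definition loc_functor : functor C localization :=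
  @Functor C localization (fun a => a) LMor LMorHeq LMorId LMorComp.

Section Lift.
Variables (D : category) (F : functor C D).
Variable Finv : forall (a b : C) (w : hom a b), W w -> hom (F b) (F a).
Hypothesis FinvP : forall (a b : C) (w : hom a b) (Ww : W w),
  inverse_pair (fmor F w) (Finv Ww).

Fixpoint lift_mor (a b : C) (f : lhom a b) : hom (F a) (F b) :=
  match f with
  | LId a => idm (F a)
  | LMor a b f => fmor F f
  | LInv a b w Ww => Finv Ww
  | LComp a b c g f => comp (lift_mor g) (lift_mor f)
  end.

Lemma lift_mor_heq a b (f g : lhom a b) :
  leq_lhom f g -> heq (lift_mor f) (lift_mor g).
Proof.
elim=> {a b f g} /=.
- by move=> *; apply: heq_refl.
- by move=> *; apply: heq_sym.
- by move=> a b f g h _ fg _ gh; apply: heq_trans fg gh.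
- by move=> *; apply: comp_heq.
- by move=> *; apply: comp_assoc.
- by move=> *; apply: comp_idl.
- by move=> *; apply: comp_idr.
- by move=> *; apply: fmor_heq.
- by move=> *; apply: fmor_id.
- by move=> *; apply: fmor_comp.
- by move=> a b w Ww; case: (FinvP Ww).
- by move=> a b w Ww; case: (FinvP Ww).
Qed.

Definition loc_lift : functor localization D :=
  @Functor localization D F lift_mor lift_mor_heq
    (fun a => heq_refl _) (fun a b c g f => heq_refl _).

Definition loc_liftK : nat_iso (comp_functor loc_lift loc_functor) F.
Proof.
apply: (@NatIso _ _ (comp_functor loc_lift loc_functor) F
  (fun a => idm (F a)) (fun a => idm (F a))).
- by move=> a; split; apply: comp_idl.
- by move=> a b f; apply: heq_trans (comp_idl _) (heq_sym (comp_idr _)).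
Defined.

End Lift.

Definition loc_lift_unique (D : category) (G H : functor localization D) :
  nat_iso (comp_functor G loc_functor) (comp_functor H loc_functor) ->
  nat_iso G H.
Proof.
case=> /= e e' eP nat_e; apply: (@NatIso _ _ G H e e') => // a b f.
elim: f => {a b} [a|a b f|a b w Ww|a b c g IHg f IHf].
- apply: heq_trans (comp_heq (heq_refl _) (fmor_id G a)) _.
  apply: heq_trans (comp_idr _) _; apply: heq_sym.
  by apply: heq_trans (comp_heq (fmor_id H a) (heq_refl _)) (comp_idl _).
- exact: nat_e.
- have hG : heq (comp (fmor G (LMor w)) (fmor G (LInv Ww))) (idm _).
    apply: heq_trans (heq_sym (fmor_comp G _ _)) _.
    exact: heq_trans (fmor_heq G (LInvr Ww)) (fmor_id G b).
  have hH : heq (comp (fmor H (LInv Ww)) (fmor H (LMor w))) (idm _).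
    apply: heq_trans (heq_sym (fmor_comp H _ _)) _.
    exact: heq_trans (fmor_heq H (LInvl Ww)) (fmor_id H a).
  apply: heq_trans (heq_sym (comp_idl _)) _.
  apply: heq_trans (comp_heq (heq_sym hH) (heq_refl _)) _.
  apply: heq_trans (heq_sym (comp_assoc _ _ _)) _.
  apply: comp_heq; first exact: heq_refl.
  apply: heq_trans (comp_assoc _ _ _) _.
  apply: heq_trans (comp_heq (heq_sym (nat_e _ _ w)) (heq_refl _)) _.
  apply: heq_trans (heq_sym (comp_assoc _ _ _)) _.
  exact: heq_trans (comp_heq (heq_refl _) hG) (comp_idr _).
- apply: heq_trans (comp_heq (heq_refl _) (fmor_comp G g f)) _.
  apply: heq_trans (comp_assoc _ _ _) _.
  apply: heq_trans (comp_heq IHg (heq_refl _)) _.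
  apply: heq_trans (heq_sym (comp_assoc _ _ _)) _.
  apply: heq_trans (comp_heq (heq_refl _) IHf) _.
  apply: heq_trans (comp_assoc _ _ _) _.
  exact: comp_heq (heq_sym (fmor_comp H g f)) (heq_refl _).
Defined.

End Localization.

(* ------------------------------------------------------------------------ *)
(* Quivers and paths                                                         *)
(* ------------------------------------------------------------------------ *)

Record quiver := Quiver {
  vertex : finType;
  arrow : finType;
  source : arrow -> vertex;
  target : arrow -> vertex
}.

Definition incidence (Q : quiver) : 'M[nat]_#|vertex Q| :=
  \matrix_(i, j)
    #|[set a : arrow Q | (source a == enum_val j) && (target a == enum_val i)]|.

Section Paths.
Variable Q : quiver.
Implicit Types (v : vertex Q) (s : seq (arrow Q)).

(* [s] lists the arrows in the order in which they are followed. *)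
Fixpoint is_walk v s : bool :=
  if s is a :: s' then (source a == v) && is_walk (target a) s' else true.

Definition walk_end v s : vertex Q := last v (map (@target Q) s).

(* The starting vertex is recorded to distinguish the trivial paths. *)
Record qpath := QPath {
  qpath_val : vertex Q * seq (arrow Q);
  _ : is_walk qpath_val.1 qpath_val.2
}.

HB.instance Definition _ := [isSub for qpath_val].
HB.instance Definition _ := [Choice of qpath by <:].

Definition psource (p : qpath) : vertex Q := (val p).1.
Definition parrows (p : qpath) : seq (arrow Q) := (val p).2.
Definition ptarget (p : qpath) : vertex Q := walk_end (psource p) (parrows p).
Definition plength (p : qpath) : nat := size (parrows p).

Definition trivial_path v : qpath := @QPath (v, [::]) isT.

(* [q] followed by [p], when composable; [insub] then never fails, see       *)
(* [pcompE].                                                                 *)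
Definition pcomp (p q : qpath) : option qpath :=
  if ptarget q == psource p then insub (psource q, parrows q ++ parrows p)
  else None.

Lemma is_walk_cat v s t :
  is_walk v (s ++ t) = is_walk v s && is_walk (walk_end v s) t.
Proof. by elim: s v => //= a s IHs v; rewrite IHs andbA. Qed.

Lemma walk_end_cat v s t : walk_end v (s ++ t) = walk_end (walk_end v s) t.
Proof. by rewrite /walk_end map_cat last_cat. Qed.

Lemma pcompE p q : omap val (pcomp p q) =
  if ptarget q == psource p then Some (psource q, parrows q ++ parrows p)
  else None.
Proof.
rewrite /pcomp; case: eqP => // epq; case: insubP => /= [r _ -> //|].
case: p q epq => [[u s] /= us] [[v t] /= vt]; rewrite /ptarget /psource /=.
by rewrite /parrows /= => epq; rewrite is_walk_cat vt epq us.
Qed.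

Lemma pcompN p q : ptarget q != psource p -> pcomp p q = None.
Proof. by rewrite /pcomp => /negbTE->. Qed.

Lemma pcompS p q : ptarget q = psource p ->
  {r | pcomp p q = Some r & [/\ psource r = psource q, ptarget r = ptarget p
                             & parrows r = parrows q ++ parrows p]}.
Proof.
move=> epq; have := pcompE p q; rewrite epq eqxx; case: (pcomp p q) => //= r.
case=> er; exists r => //.
rewrite /ptarget {1 3}/psource {1 3}/parrows [val r]er /=; split=> //.
by rewrite walk_end_cat -/(psource q) -/(ptarget q) epq.
Qed.

Lemma pcompA p q r :
  obind (pcomp p) (pcomp q r) = obind (pcomp^~ r) (pcomp p q).
Proof.
have [erq|nrq] := eqVneq (ptarget r) (psource q); last first.
  rewrite (pcompN nrq) /=; have [eqp|nqp] := eqVneq (ptarget q) (psource p).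
    by have [x -> [sx _ _] /=] := pcompS eqp; rewrite pcompN // sx.
  by rewrite (pcompN nqp).
have [x -> [sx tx ax] /=] := pcompS erq.
have [eqp|nqp] := eqVneq (ptarget q) (psource p); last first.
  by rewrite (pcompN nqp) pcompN // tx.
have [y -> [sy ty ay] /=] := pcompS eqp.
have /pcompS[z -> [sz _ az]] : ptarget x = psource p by rewrite tx.
have /pcompS[t -> [st _ at_]] : ptarget r = psource y by rewrite sy.
congr Some; apply/val_inj.
rewrite [LHS]surjective_pairing [RHS]surjective_pairing.
rewrite -/(psource z) -/(psource t) -/(parrows z) -/(parrows t).
by rewrite sz st sx az at_ ax ay catA.
Qed.

Lemma pcomp_idl v q :
  pcomp (trivial_path v) q = if ptarget q == v then Some q else None.
Proof.
rewrite /pcomp; case: eqP => // _; rewrite cats0 -surjective_pairing.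
exact: valK.
Qed.

Lemma pcomp_idr v p :
  pcomp p (trivial_path v) = if psource p == v then Some p else None.
Proof.
rewrite /pcomp eq_sym -[ptarget _]/v; case: eqP => // <-.
rewrite -[psource (trivial_path _)]/(psource p) -[parrows _ ++ _]/(parrows p).
by rewrite -surjective_pairing valK.
Qed.

(* The paths of length m, as a finite type. *)
Definition path_of_length (m : nat) :=
  {x : vertex Q * m.-tuple (arrow Q) | is_walk x.1 x.2}.

HB.instance Definition _ m := Finite.on (path_of_length m).

Definition qpath_of_length m (x : path_of_length m) : qpath :=
  @QPath ((val x).1, tval (val x).2) (valP x).

End Paths.

Definition quiver_power (Q : quiver) (m : nat) : quiver :=
  {| vertex := vertex Q;
     arrow := path_of_length Q m;
     source := fun x => psource (qpath_of_length x);
     target := fun x => ptarget (qpath_of_length x) |}.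

Section IncidencePower.
Variable Q : quiver.
Local Open Scope nat_scope.

Let walks m (u v : vertex Q) : nat :=
  \sum_(t : m.-tuple (arrow Q)) (is_walk u t && (walk_end u t == v)).

Let walksS m u v :
  walks m.+1 u v =
  \sum_w #|[set a : arrow Q | (source a == u) && (target a == w)]| * walks m w v.
Proof.
pose f (x : arrow Q * m.-tuple (arrow Q)) := cons_tuple x.1 x.2.
have f_bij : bijective f.
  exists (fun t => (thead t, behead_tuple t)) => [[a t]|t].
    by congr pair; apply: val_inj.
  by rewrite /f /= [RHS]tuple_eta; apply: val_inj.
rewrite /walks (reindex f) /=; last exact: onW_bij.
pose g a (t : m.-tuple (arrow Q)) : nat := (source a == u) *
   (is_walk (target a) t && (walk_end (target a) t == v)).
rewrite (eq_bigr (fun x => g x.1 x.2)); last first.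
  by move=> [a t] _; rewrite /g mulnb andbA.
rewrite -(pair_bigA _ g) /=.
rewrite (partition_big (@target Q) xpredT) //=; apply: eq_bigr => w _.
rewrite -sum1_card big_distrl /= big_mkcond [RHS]big_mkcond /=.
apply: eq_bigr => a _; rewrite inE /g; case: (eqVneq (target a) w) => [->|_].
  by rewrite andbT -big_distrr; case: eqP => //= _; rewrite mul1n.
by rewrite andbF.
Qed.

Let card_walks m (u v : vertex Q) :
  #|[set x : arrow (quiver_power Q m) | (source x == u) && (target x == v)]| =
  walks m u v.
Proof.
pose h (x : path_of_length Q m) := (val x).2.
rewrite -(@card_in_imset _ _ h); last first.
  move=> x y; rewrite !inE => /andP[/eqP xu _] /andP[/eqP yu _] hxy.
  apply: val_inj; rewrite [LHS]surjective_pairing [RHS]surjective_pairing.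
  by congr pair => //; apply: etrans xu (esym yu).
rewrite /walks (eq_bigr (fun t : m.-tuple _ =>
  if is_walk u t && (walk_end u t == v) then 1 else 0)); last first.
  by move=> t _; case: andP.
rewrite -big_mkcond sum1_card -[RHS]cardsE; congr #|pred_of_set _|.
apply/setP => t; rewrite inE; apply/imsetP/andP => [[x]|[ut tv]].
  by rewrite inE => /andP[/eqP <- xv] ->; split=> //; apply: (valP x).
have ut' : is_walk (u, t).1 (u, t).2 by [].
by exists (exist _ (u, t) ut'); rewrite // inE eqxx.
Qed.

Lemma incidence_power m : incidence (quiver_power Q m) = (incidence Q ^+ m)%R.
Proof.
elim: m => [|m IHm]; apply/matrixP => i j.
  rewrite expr0 !mxE card_walks /walks.
  rewrite (bigD1 [tuple]) //= big1 ?addn0 => [|t]; last by rewrite (tuple0 t).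
  by rewrite /walk_end /= (inj_eq enum_val_inj) eq_sym; case: eqP.
rewrite exprSr -IHm !mxE card_walks walksS.
rewrite (reindex _ (onW_bij _ (enum_val_bij _))) /=.
apply: eq_bigr => l _; rewrite !mxE card_walks mulnC; congr (_ * _).
Qed.

End IncidencePower.

(* ------------------------------------------------------------------------ *)
(* The path algebra kQ: finitely supported k-valued functions on the paths   *)
(* ------------------------------------------------------------------------ *)

Section PathAlgebra.
Variables (k : fieldType) (Q : quiver).

(* An alias of [{malg k[qpath Q]}], on which [monalg] puts a product only    *)
(* when the basis is a monoid.                                               *)
Definition path_algebra := {malg k[qpath Q]}.

HB.instance Definition _ := GRing.Lmodule.on path_algebra.

Implicit Types (a b : path_algebra) (p q : qpath Q).

Definition opath_elt (c : k) (o : option (qpath Q)) : path_algebra :=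
  if o is Some p then << c *g p >> else 0.

Definition pa_mul a b : path_algebra :=
  \sum_(p <- msupp a) \sum_(q <- msupp b) opath_elt (a@_p * b@_q) (pcomp p q).

Definition pa_one : path_algebra := \sum_(v : vertex Q) << trivial_path v >>.

Lemma opath_elt0 o : opath_elt 0 o = 0.
Proof. by case: o => //= p; rewrite monalgU0. Qed.

Lemma opath_eltD c d o : opath_elt (c + d) o = opath_elt c o + opath_elt d o.
Proof. by case: o => [p|] /=; rewrite ?monalgUD ?addr0. Qed.

Local Open Scope fset_scope.

Lemma pa_mulw (A B : {fset qpath Q}) a b : msupp a `<=` A -> msupp b `<=` B ->
  pa_mul a b =
  \sum_(p <- A) \sum_(q <- B) opath_elt (a@_p * b@_q) (pcomp p q).
Proof.
move=> aA bB; rewrite /pa_mul (big_fset_incl _ aA) /=.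
  apply: eq_bigr => p _; apply: big_fset_incl => // q _ /mcoeff_outdom ->.
  by rewrite mulr0 opath_elt0.
move=> p _ /mcoeff_outdom ap; rewrite big1 // => q _.
by rewrite ap mul0r opath_elt0.
Qed.

Lemma pa_mulUU c d p q :
  pa_mul << c *g p >> << d *g q >> = opath_elt (c * d) (pcomp p q).
Proof. by rewrite (pa_mulw msuppU_le msuppU_le) !big_seq_fset1 !mcoeffUU. Qed.

Lemma pa_mulDl : left_distributive pa_mul +%R.
Proof.
move=> a b c; rewrite (pa_mulw (msuppD_le a b) (fsubset_refl _)).
rewrite (pa_mulw (fsubsetUl _ (msupp b)) (fsubset_refl _)).
rewrite (pa_mulw (fsubsetUr (msupp a) _) (fsubset_refl _)).
rewrite -big_split /=; apply: eq_bigr => p _.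
rewrite -big_split /=; apply: eq_bigr => q _.
by rewrite mcoeffD mulrDl opath_eltD.
Qed.

Lemma pa_mulDr : right_distributive pa_mul +%R.
Proof.
move=> c a b; rewrite (pa_mulw (fsubset_refl _) (msuppD_le a b)).
rewrite (pa_mulw (fsubset_refl _) (fsubsetUl _ (msupp b))).
rewrite (pa_mulw (fsubset_refl _) (fsubsetUr (msupp a) _)).
rewrite -big_split /=; apply: eq_bigr => p _.
rewrite -big_split /=; apply: eq_bigr => q _.
by rewrite mcoeffD mulrDr opath_eltD.
Qed.

Lemma pa_mul0l : left_zero 0 pa_mul.
Proof. by move=> a; rewrite /pa_mul msupp0 big_seq_fset0. Qed.

Lemma pa_mul0r : right_zero 0 pa_mul.
Proof.
by move=> a; rewrite /pa_mul big1 // => p _; rewrite msupp0 big_seq_fset0.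
Qed.

Lemma pa_mul_suml I (r : seq I) (P : pred I) (F : I -> path_algebra) b :
  pa_mul (\sum_(i <- r | P i) F i) b = \sum_(i <- r | P i) pa_mul (F i) b.
Proof. exact: (big_morph (pa_mul^~ b) (fun x y => pa_mulDl x y b) (pa_mul0l b)). Qed.

Lemma pa_mul_sumr I (r : seq I) (P : pred I) (F : I -> path_algebra) a :
  pa_mul a (\sum_(i <- r | P i) F i) = \sum_(i <- r | P i) pa_mul a (F i).
Proof. exact: (big_morph (pa_mul a) (fun x y => pa_mulDr a x y) (pa_mul0r a)). Qed.

Lemma pa_mulA_basis c d e p q r :
  pa_mul << c *g p >> (pa_mul << d *g q >> << e *g r >>) =
  pa_mul (pa_mul << c *g p >> << d *g q >>) << e *g r >>.
Proof.
rewrite !pa_mulUU; have := pcompA p q r.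
case: (pcomp q r) (pcomp p q) => [x|] [y|] /= epqr;
  rewrite ?pa_mulUU ?pa_mul0l ?pa_mul0r // ?mulrA ?epqr //.
by rewrite -epqr.
Qed.

Lemma pa_mulA : associative pa_mul.
Proof.
move=> a b c; move: pa_mul pa_mul_suml pa_mul_sumr pa_mulA_basis.
move=> mul mul_suml mul_sumr mulA_basis.
rewrite {1 2}[a]monalgE !mul_suml; apply: eq_bigr => p _.
rewrite {1 2}[b]monalgE !(mul_suml, mul_sumr); apply: eq_bigr => q _.
by rewrite {1 2}[c]monalgE !mul_sumr; apply: eq_bigr => r _.
Qed.

Lemma pa_mul1l : left_id pa_one pa_mul.
Proof.
move=> a; rewrite [in LHS](monalgE a) [RHS]monalgE pa_mul_sumr.
apply: eq_bigr => q _; rewrite pa_mul_suml (bigD1 (ptarget q)) //=.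
rewrite pa_mulUU pcomp_idl eqxx /= mul1r big1 ?addr0 // => v nv.
by rewrite pa_mulUU pcomp_idl eq_sym (negbTE nv).
Qed.

Lemma pa_mul1r : right_id pa_one pa_mul.
Proof.
move=> a; rewrite [in LHS](monalgE a) [RHS]monalgE pa_mul_suml.
apply: eq_bigr => p _; rewrite pa_mul_sumr (bigD1 (psource p)) //=.
rewrite pa_mulUU pcomp_idr eqxx /= mulr1 big1 ?addr0 // => v nv.
by rewrite pa_mulUU pcomp_idr eq_sym (negbTE nv).
Qed.

(* Not an [nzRingType]: kQ = 0 when Q has no vertex. *)
HB.instance Definition _ := GRing.Zmodule_isPzRing.Build path_algebra
  pa_mulA pa_mul1l pa_mul1r pa_mulDl pa_mulDr.

Definition homogeneous (d : nat) (a : path_algebra) : Prop :=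
  forall p, p \in msupp a -> plength p = d.

End PathAlgebra.

(* ------------------------------------------------------------------------ *)
(* Gr(kQ), Fdim(kQ) and QGr(kQ)                                              *)
(* ------------------------------------------------------------------------ *)

Section GradedModules.
Variables (k : fieldType) (Q : quiver).
Local Notation kQ := (path_algebra k Q).

(* M is the internal direct sum of the additive subgroups [gdeg M i]. *)
Record grmod := GrMod {
  gmod :> lmodType kQ;
  gdeg : int -> gmod -> Prop;
  gdeg0 : forall i, gdeg i 0;
  gdegB : forall i x y, gdeg i x -> gdeg i y -> gdeg i (x - y);
  gdegZ : forall d i a x,
    homogeneous d a -> gdeg i x -> gdeg (d%:Z + i) (a *: x);
  gdeg_sum : forall x, exists (s : seq int) (f : int -> gmod),
    (forall i, gdeg i (f i)) /\ x = \sum_(i <- s) f i;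
  gdeg_direct : forall (s : seq int) (f : int -> gmod), uniq s ->
    (forall i, gdeg i (f i)) -> \sum_(i <- s) f i = 0 ->
    forall i, i \in s -> f i = 0
}.

Record grhom (M N : grmod) := GrHom {
  glin :> {linear M -> N};
  glin_deg : forall i x, @gdeg M i x -> @gdeg N i (glin x)
}.

Definition grhom_id (M : grmod) : grhom M M := @GrHom M M idfun (fun _ _ h => h).

Definition grhom_comp (M N P : grmod) (g : grhom N P) (f : grhom M N) :
    grhom M P :=
  @GrHom M P (g \o f) (fun i x h => glin_deg g (glin_deg f h)).

Definition Gr : category.
Proof.
apply: (@Category grmod grhom (fun M N f g => f =1 g) grhom_id grhom_comp) => //.
- by move=> M N f g fg x; rewrite fg.
- by move=> M N f g h fg gh x; rewrite fg.
- by move=> M N P g g' f f' gg ff x /=; rewrite ff gg.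
Defined.

(* A submodule of M in Gr(kQ), i.e. a graded one. *)
Definition grsub (M : grmod) (N : M -> Prop) : Prop :=
  [/\ N 0,
      forall (a : kQ) x y, N x -> N y -> N (a *: x + y)
    & forall x, N x -> exists (s : seq int) (f : int -> M),
        (forall i, gdeg i (f i) /\ N (f i)) /\ x = \sum_(i <- s) f i].

(* N is spanned over k by a finite family of its elements; a scalar c of k   *)
(* acts as the element c 1 of kQ.                                            *)
Definition findim (M : grmod) (N : M -> Prop) : Prop :=
  exists s : seq M, (forall y, y \in s -> N y) /\
    forall x, N x -> exists c : M -> k,
      x = \sum_(y <- s) (c y *: (1 : kQ)) *: y.

Definition Fdim (M : grmod) : Prop :=
  forall x : M, exists s : seq M, x = \sum_(y <- s) y /\
    forall y, y \in s -> exists N : M -> Prop, [/\ grsub N, findim N & N y].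

(* There is an exact sequence 0 -> K -> M -> N -> C -> 0 in Gr(kQ) with K    *)
(* and C in Fdim(kQ).                                                        *)
Definition Fdim_iso (M N : Gr) (f : hom M N) : Prop :=
  exists (K C : grmod) (i : grhom K M) (p : grhom N C),
    [/\ Fdim K, Fdim C,
        injective i /\ (forall x : M, f x = 0 <-> exists z, x = i z)
      & (forall z : C, exists y, z = p y) /\
        (forall y : N, p y = 0 <-> exists x, y = f x)].

(* The quotient of the abelian category Gr(kQ) by its Serre subcategory      *)
(* Fdim(kQ): the localization at the morphisms whose kernel and cokernel     *)
(* belong to Fdim(kQ).                                                       *)
Definition QGr : category := localization Fdim_iso.

End GradedModules.

(* Main.v *)
(* Let phi : kQ^(m) -> kQ be the embedding that concatenates paths; its image is
   the sum of the components of kQ of degree divisible by m, and phi has a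
   kQ^(m)-linear retraction psi that kills the other components.  The Veronese
   functor V(M) = (+)_i M_(mi) has as right adjoint G(N), the graded part of
   Hom_kQ^(m)(kQ, N): the unit sends x to (a |-> the V(M)-component of a x), and
   the counit F |-> F(1) is an isomorphism with inverse n |-> (a |-> psi(a) n).

   A module is in Fdim iff each of its elements is killed by all long enough
   paths; hence f is inverted in QGr iff long paths kill each element of ker f
   and send each element of the target into im f.  Long paths in Q are those
   that contain long paths of Q^(m) after a bounded initial segment, which may be
   chosen to shift a given degree to a multiple of m; so f is inverted in QGr
   iff V f is.  As V G is isomorphic to the identity, G also preserves the
   inverted morphisms, and as the counit at V(M) is an isomorphism inverse to V
   applied to the unit, the unit is inverted too. *)

From HB Require Import structures.
From mathcomp Require Import all_boot all_order all_algebra.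
From mathcomp Require Import finmap boolp zify.
From mathcomp.multinomials Require Import monalg.
Require Import Defs.

Set Implicit Arguments.
Unset Strict Implicit.
Unset Printing Implicit Defensive.

Import GRing.Theory.
Local Open Scope ring_scope.

(** * Functors and equivalences between localized categories *)

Section LocalizedEquivalence.
Variables (C D : category).
Variables (W : forall a b : C, hom a b -> Prop).
Variables (X : forall a b : D, hom a b -> Prop).

Lemma fmor_loc_inverse_pair (F : functor C D)
    (FW : forall (a b : C) (w : hom a b), W w -> X (fmor F w))
    (a b : C) (w : hom a b) (Ww : W w) :
  @inverse_pair (localization X) (F a) (F b) (LMor X (fmor F w)) (LInv (FW _ _ w Ww)).
Proof. by split; [apply: LInvl | apply: LInvr]. Qed.

Definition loc_fmor (F : functor C D)
    (FW : forall (a b : C) (w : hom a b), W w -> X (fmor F w)) :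
    functor (localization W) (localization X) :=
  @loc_lift C W (localization X) (comp_functor (loc_functor X) F) _
    (fmor_loc_inverse_pair FW).
End LocalizedEquivalence.

(** By [loc_lift_unique], natural isomorphisms between functors on a localization can be built on
    the morphisms of the original category. The unit becomes invertible because its components lie
    in [W]; the counit is an isomorphism already in [D]. *)
Lemma localized_equivalence (C D : category)
    (W : forall a b : C, hom a b -> Prop) (X : forall a b : D, hom a b -> Prop)
    (V : functor C D) (G : functor D C)
    (VW : forall (a b : C) (w : hom a b), W a b w -> X _ _ (fmor V w))
    (GX : forall (a b : D) (w : hom a b), X a b w -> W _ _ (fmor G w))
    (eta : forall a : C, hom a (G (V a)))
    (eta_natural : forall (a b : C) (f : hom a b),
       heq (comp (eta b) f) (comp (fmor G (fmor V f)) (eta a)))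
    (etaW : forall a, W _ _ (eta a))
    (eps : nat_iso (comp_functor V G) (id_functor D)) :
  equivalent_categories (localization W) (localization X).
Proof.
exists (loc_fmor VW), (loc_fmor GX); split; constructor.
- apply: loc_lift_unique.
  apply: (@NatIso _ _ (comp_functor (comp_functor (loc_fmor GX) (loc_fmor VW))
      (loc_functor W)) (comp_functor (id_functor _) (loc_functor W))
    (fun a => LInv (etaW a)) (fun a => LMor W (eta a))).
  + by move=> a; split; [apply: LInvr | apply: LInvl].
  + move=> a b f; rewrite /=.
    (* Insert on the right [eta a] composed with its formal inverse. Naturality then turns [G (V f)]
       after [eta a] into [eta b] after [f], and [eta b] cancels. *)
    apply: LTrans (LSym (LIdr _)) _.
    apply: LTrans (LCompCong (LRefl _) (LSym (LInvr (etaW a)))) _.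
    apply: LTrans (LAssoc _ _ _) _; apply: LCompCong; last exact: LRefl.
    apply: LTrans (LSym (LAssoc _ _ _)) _.
    apply: LTrans (LCompCong (LRefl _) (LSym (LMorComp _ _ _))) _.
    apply: LTrans (LCompCong (LRefl _) (LMorHeq _ (heq_sym (eta_natural _ _ f)))) _.
    apply: LTrans (LCompCong (LRefl _) (LMorComp _ _ _)) _.
    apply: LTrans (LAssoc _ _ _) _.
    by apply: LTrans (LCompCong (LInvl _) (LRefl _)) _; apply: LIdl.
- apply: loc_lift_unique; case: eps => e e' ee' e_nat.
  apply: (@NatIso _ _ (comp_functor (comp_functor (loc_fmor VW) (loc_fmor GX))
      (loc_functor X)) (comp_functor (id_functor _) (loc_functor X))
    (fun a => LMor X (e a)) (fun a => LMor X (e' a))).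
  + move=> a; have [e1 e2] := ee' a; split=> /=.
    * by apply: LTrans (LSym (LMorComp _ _ _)) _; apply: LTrans (LMorHeq _ e1) _; apply: LMorId.
    * by apply: LTrans (LSym (LMorComp _ _ _)) _; apply: LTrans (LMorHeq _ e2) _; apply: LMorId.
  + move=> a b f /=.
    apply: LTrans (LSym (LMorComp _ _ _)) _.
    by apply: LTrans (LMorHeq _ (e_nat _ _ f)) _; apply: LMorComp.
Qed.

(** * Computing in the path algebra through monomials *)

Lemma malgUZ (k : fieldType) (K : choiceType) (c : k) (x : K) :
  << c *g x >> = c *: << x >> :> {malg k[K]}.
Proof. by apply/malgP => y; rewrite mcoeffZ !mcoeffU mulr_natr. Qed.

(* Failing conversion tests would otherwise unfold finitely supported functions. *)
Local Opaque fgzero fgopp fgadd fgscale mkmalgU pa_mul pa_one.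

(** Locked, so that monomials are handled through the rules below. The coefficient may be 0, which
    makes [mono] additive in it. *)
HB.lock Definition mono (k : fieldType) (Q : quiver) (c : k) (p : qpath Q) :
  path_algebra k Q := << c *g p >>.

Section PathAlgebraBasis.
Variables (k : fieldType) (Q : quiver).
Local Notation kQ := (path_algebra k Q).
Implicit Types (c : k) (a b : kQ) (p q : qpath Q).

Lemma pa_ind (P : kQ -> Prop) :
  P 0 -> (forall c p, P (mono c p)) -> (forall a b, P a -> P b -> P (a + b)) ->
  forall a, P a.
Proof.
rewrite mono.unlock => P0 Pp PD a.
rewrite (monalgE a); apply: (big_ind P) => // p _; apply: Pp.
Qed.

Lemma monoD c d p : mono (c + d) p = mono c p + mono d p.
Proof. by rewrite mono.unlock; apply: monalgUD. Qed.

Lemma mono0 p : mono 0 p = 0 :> kQ.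
Proof. by rewrite mono.unlock; apply: monalgU0. Qed.

Lemma monoM c d p q : mono c p * mono d q = oapp (mono (c * d)) 0 (pcomp p q).
Proof. by rewrite mono.unlock [LHS]pa_mulUU; case: pcomp. Qed.

Lemma pa_oneE : 1 = \sum_(v : vertex Q) mono 1 (trivial_path v) :> kQ.
Proof. by rewrite mono.unlock. Qed.

(** This is c times 1, by [kscalE], spread over the trivial paths so that products with monomials
    reduce to [pcomp]. *)
Definition kscal (c : k) : kQ := \sum_(v : vertex Q) mono c (trivial_path v).

Lemma kscal1 : kscal 1 = 1.
Proof. by rewrite pa_oneE. Qed.

Lemma kscalE c : kscal c = c *: (1 : kQ).
Proof.
rewrite /kscal pa_oneE scaler_sumr mono.unlock; apply: eq_bigr => v _.
exact: malgUZ.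
Qed.

Lemma kscal0 : kscal 0 = 0.
Proof. by rewrite /kscal big1 // => v _; rewrite mono0. Qed.

Lemma kscalD c d : kscal (c + d) = kscal c + kscal d.
Proof. by rewrite /kscal -big_split; apply: eq_bigr => v _; rewrite monoD. Qed.

Lemma kscal_mono c d p : kscal c * mono d p = mono (c * d) p.
Proof.
rewrite /kscal mulr_suml (bigD1 (ptarget p)) //= monoM pcomp_idl eqxx /=.
rewrite big1 ?addr0 // => v vp.
by rewrite monoM pcomp_idl eq_sym (negbTE vp).
Qed.

Lemma monoE c p : mono c p = kscal c * mono 1 p.
Proof. by rewrite kscal_mono mulr1. Qed.

Lemma homog_mono c p : homogeneous (plength p) (mono c p).
Proof. by move=> q; rewrite mono.unlock msuppU; case: eqP => // _; rewrite inE => /eqP->. Qed.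

Lemma homog0 d : homogeneous d (0 : kQ).
Proof. by move=> p; rewrite msupp0. Qed.

Lemma homogD d a b : homogeneous d a -> homogeneous d b -> homogeneous d (a + b).
Proof.
move=> da db p /(fsubsetP (msuppD_le _ _)).
by rewrite in_fsetU => /orP[/da|/db].
Qed.

Lemma homog_kscal c : homogeneous 0 (kscal c).
Proof.
apply: big_ind => [||v _]; [exact: homog0 | exact: homogD|].
exact: (@homog_mono c (trivial_path v)).
Qed.

Lemma homog_ind d (P : kQ -> Prop) :
  P 0 -> (forall c p, plength p = d -> P (mono c p)) ->
  (forall a b, P a -> P b -> P (a + b)) ->
  forall a, homogeneous d a -> P a.
Proof.
rewrite mono.unlock => P0 Pp PD a da; rewrite (monalgE a) big_seq.
by apply: big_ind => // p /da pd; apply: Pp.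
Qed.

Lemma pa_additive_eq (V : zmodType) (u v : kQ -> V) :
  {morph u : a b / a + b} -> {morph v : a b / a + b} ->
  (forall c p, u (mono c p) = v (mono c p)) -> u =1 v.
Proof.
move=> uD vD uv; have f0 (f : kQ -> V) : {morph f : a b / a + b} -> f 0 = 0.
  by move=> fD; apply: (addrI (f 0)); rewrite -fD !addr0.
by elim/pa_ind => [|c p|a b ua ub]; rewrite ?f0 // uD vD ua ub.
Qed.

(** Extends a map from monomials to all of kQ. As [V] is a mere abelian group, linearity over k is
    replaced by additivity of [h] in the coefficient. *)
Definition lext (V : zmodType) (h : k -> qpath Q -> V) a : V :=
  \sum_(p <- msupp a) h a@_p p.

Section LinearExtension.
Variables (V : zmodType) (h : k -> qpath Q -> V).
Hypothesis hD : forall c d p, h (c + d) p = h c p + h d p.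

Let h0 p : h 0 p = 0.
Proof. by apply: (addrI (h 0 p)); rewrite -hD !addr0. Qed.

Lemma lextw (A : {fset qpath Q}) a : (msupp a `<=` A)%fset ->
  lext h a = \sum_(p <- A) h a@_p p.
Proof. by move=> aA; apply: big_fset_incl => // p _ /mcoeff_outdom ->. Qed.

Lemma lextD a b : lext h (a + b) = lext h a + lext h b.
Proof.
rewrite (lextw (msuppD_le a b)) (lextw (fsubsetUl _ (msupp b))).
rewrite (lextw (fsubsetUr (msupp a) _)) -big_split; apply: eq_bigr => p _.
by rewrite mcoeffD hD.
Qed.

Lemma lext0 : lext h 0 = 0.
Proof. by rewrite /lext msupp0 big_seq_fset0. Qed.

Lemma lext_mono c p : lext h (mono c p) = h c p.
Proof. by rewrite mono.unlock (lextw msuppU_le) big_seq_fset1 mcoeffUU. Qed.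

End LinearExtension.

End PathAlgebraBasis.

Lemma pa_biadditive_eq (k : fieldType) (Q Q' : quiver) (V : zmodType)
    (u v : path_algebra k Q -> path_algebra k Q' -> V) :
  (forall b, {morph u^~ b : a a' / a + a'}) ->
  (forall a, {morph u a : b b' / b + b'}) ->
  (forall b, {morph v^~ b : a a' / a + a'}) ->
  (forall a, {morph v a : b b' / b + b'}) ->
  (forall c p d q, u (mono c p) (mono d q) = v (mono c p) (mono d q)) ->
  u =2 v.
Proof.
move=> uDl uDr vDl vDr uv a b.
apply: (pa_additive_eq (u := u^~ b) (v := v^~ b)) => // c p.
by apply: pa_additive_eq => // d q.
Qed.

Arguments homog_mono {k Q} c p.

Local Opaque lext kscal homogeneous.

(** * Paths of the power quiver, concatenated to paths of Q *)

Section PowerPaths.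
Variables (Q : quiver) (m : nat).
Hypothesis m_gt0 : (0 < m)%N.
Local Notation Qm := (quiver_power Q m).
Implicit Types (v : vertex Q) (s : seq (arrow Qm)) (p q : qpath Qm).

Definition flat_arrows s : seq (arrow Q) :=
  flatten (map (fun x : path_of_length Q m => tval (val x).2) s).

Lemma is_walk_flat v s :
  @is_walk Qm v s -> is_walk v (flat_arrows s).
Proof.
elim: s v => //= x s IHs v /andP[/eqP <- /IHs xs].
rewrite /flat_arrows /= is_walk_cat; apply/andP; split; last exact: xs.
exact: (valP x).
Qed.

Lemma walk_end_flat v s :
  @is_walk Qm v s -> walk_end v (flat_arrows s) = @walk_end Qm v s.
Proof.
elim: s v => //= x s IHs v /andP[/eqP <- /IHs xs].
by rewrite /flat_arrows /= walk_end_cat; apply: xs.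
Qed.

Lemma size_flat_arrows s : size (flat_arrows s) = (m * size s)%N.
Proof.
by elim: s => [|x s IHs]; rewrite ?muln0 // size_cat size_tuple IHs mulnS.
Qed.

(** All blocks have the same positive length m, so a concatenation can be cut in one way only. An
    arrow of the power quiver also records its starting vertex, which the walk condition
    recovers. *)
Lemma flat_arrows_inj v s t : @is_walk Qm v s -> @is_walk Qm v t ->
  flat_arrows s = flat_arrows t -> s = t.
Proof.
elim: s v t => [|x s IHs] v [|y t] //.
- by move=> _ _ /(congr1 size); rewrite !size_flat_arrows muln0 mulnS; lia.
- by move=> _ _ /(congr1 size); rewrite !size_flat_arrows muln0 mulnS; lia.
move=> /= /andP[/eqP sx xs] /andP[/eqP sy yt] /eqP.
rewrite eqseq_cat ?size_tuple // => /andP[/eqP exy /eqP est].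
have {}exy : x = y.
  apply: val_inj; rewrite [LHS]surjective_pairing [RHS]surjective_pairing.
  by congr pair; [apply: etrans sx (esym sy) | apply: val_inj].
by subst y; rewrite (IHs _ t xs yt est).
Qed.

(** The first m arrows form one arrow of the power quiver; induction on the number of blocks does
    the rest. *)
Lemma flat_arrows_surj n v (s : seq (arrow Q)) : is_walk v s -> size s = (m * n)%N ->
  exists2 t, @is_walk Qm v t & flat_arrows t = s.
Proof.
elim: n v s => [|n IHn] v s.
  by rewrite muln0 => _ /eqP; rewrite size_eq0 => /eqP->; exists [::].
rewrite -{1}(cat_take_drop m s) is_walk_cat mulnS => /andP[ws wd] sz.
have szt : size (take m s) == m by rewrite size_takel // sz leq_addr.
have szd : size (drop m s) = (m * n)%N by rewrite size_drop sz addKn.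
have [t wt et] := IHn _ _ wd szd.
pose x : path_of_length Q m := exist _ (v, Tuple szt) ws.
by exists (x :: t); rewrite /flat_arrows /= ?eqxx //= -/(flat_arrows t) et cat_take_drop.
Qed.

Definition flat_path p : qpath Q :=
  @QPath Q (psource p, flat_arrows (parrows p)) (is_walk_flat (valP p)).

Lemma ptarget_flat p : ptarget (flat_path p) = ptarget p.
Proof. exact: (walk_end_flat (valP p)). Qed.

Lemma plength_flat p : plength (flat_path p) = (m * plength p)%N.
Proof. exact: size_flat_arrows. Qed.

Lemma flat_path_inj : injective flat_path.
Proof.
move=> p q /(congr1 val) [] sv es; apply: val_inj.
rewrite [LHS]surjective_pairing [RHS]surjective_pairing.
congr pair; first exact: sv.
apply: (flat_arrows_inj (valP p) _ es).
by rewrite -[(val p).1]/(psource p) sv; apply: (valP q).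
Qed.

Lemma flat_path_surj (p : qpath Q) : (m %| plength p)%N -> exists q, flat_path q = p.
Proof.
move=> /dvdnP[n en]; have := @flat_arrows_surj n _ _ (valP p).
rewrite mulnC => /(_ en)[t wt et].
exists (@QPath Qm ((val p).1, t) wt); apply: val_inj => /=.
by rewrite [RHS]surjective_pairing -et.
Qed.

Lemma pcomp_flat p q : pcomp (flat_path p) (flat_path q) = omap flat_path (pcomp p q).
Proof.
have [epq|npq] := eqVneq (ptarget q) (psource p); last first.
  by rewrite (pcompN npq) pcompN // ptarget_flat.
have [r -> [sr tr ar]] := pcompS epq.
have /pcompS[t -> [st _ at_]] : ptarget (flat_path q) = psource (flat_path p).
  by rewrite ptarget_flat.
congr Some; apply/val_inj.
rewrite [LHS]surjective_pairing -/(psource t) -/(parrows t) st at_ /= sr ar.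
by rewrite /flat_arrows map_cat flatten_cat.
Qed.

Lemma flat_trivial v : flat_path (@trivial_path Qm v) = trivial_path v.
Proof. exact: val_inj. Qed.

Lemma plength_pcomp (Q' : quiver) (p q r : qpath Q') :
  pcomp p q = Some r -> plength r = (plength q + plength p)%N.
Proof.
have [epq|npq] := eqVneq (ptarget q) (psource p); last by rewrite pcompN.
have [r' -> [_ _ ar]] := pcompS epq; case=> <-.
by rewrite /plength ar size_cat.
Qed.

End PowerPaths.

(** * The embedding phi ([power_emb]) and its retraction psi ([power_proj]) *)

HB.lock Definition power_emb (k : fieldType) (Q : quiver) (m : nat) :
    path_algebra k (quiver_power Q m) -> path_algebra k Q :=
  lext (fun c p => mono c (flat_path p)).

(** A partial inverse of [flat_path], chosen classically; by injectivity there is only one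
    candidate, see [flatK]. *)
Definition unflat (Q : quiver) (m : nat) (p : qpath Q) : option (qpath (quiver_power Q m)) :=
  if pselect (exists q, @flat_path Q m q = p) is left e then Some (projT1 (cid e)) else None.

(** The default 0 is what kills the paths whose length is not a multiple of m. *)
HB.lock Definition power_proj (k : fieldType) (Q : quiver) (m : nat) :
    path_algebra k Q -> path_algebra k (quiver_power Q m) :=
  lext (fun c p => oapp (mono c) 0 (unflat m p)).

Section PowerAlgebra.
Variables (k : fieldType) (Q : quiver) (m : nat).
Hypothesis m_gt0 : (0 < m)%N.
Local Notation Qm := (quiver_power Q m).
Local Notation kQ := (path_algebra k Q).
Local Notation kQm := (path_algebra k Qm).

Local Notation power_emb := (@power_emb k Q m).
Local Notation power_proj := (@power_proj k Q m).
Local Notation unflat := (@unflat Q m).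

Lemma power_embD a b : power_emb (a + b) = power_emb a + power_emb b.
Proof. by rewrite power_emb.unlock; apply: lextD => c d p; rewrite monoD. Qed.

Lemma power_emb0 : power_emb 0 = 0.
Proof. rewrite power_emb.unlock; exact: lext0. Qed.

Lemma power_emb_mono c p : power_emb (mono c p) = mono c (flat_path p).
Proof. by rewrite power_emb.unlock; apply: lext_mono => ? ? ?; rewrite monoD. Qed.

Lemma power_embM a b : power_emb (a * b) = power_emb a * power_emb b.
Proof.
move: a b; apply: pa_biadditive_eq => [b a a'|a b b'|b a a'|a b b'|c p d q].
- by rewrite mulrDl power_embD.
- by rewrite mulrDr power_embD.
- by rewrite power_embD mulrDl.
- by rewrite power_embD mulrDr.
rewrite !power_emb_mono !monoM pcomp_flat.
by case: (pcomp p q) => [r|] /=; rewrite ?power_emb_mono ?power_emb0.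
Qed.

Lemma power_emb1 : power_emb 1 = 1.
Proof.
rewrite !pa_oneE (big_morph power_emb power_embD power_emb0).
by apply: eq_bigr => v _; rewrite power_emb_mono flat_trivial.
Qed.

Lemma homog_power_emb d a : homogeneous d a -> homogeneous (m * d)%N (power_emb a).
Proof.
elim/homog_ind: a / => [|c p <-|a b]; first by rewrite power_emb0; apply: homog0.
  by rewrite power_emb_mono -plength_flat; apply: homog_mono.
by rewrite power_embD; apply: homogD.
Qed.

Lemma flatK p : unflat (@flat_path Q m p) = Some p.
Proof.
rewrite /unflat; case: pselect => [e|[]]; last by exists p.
by case: cid => q /= /flat_path_inj->.
Qed.

Let projD c d p : oapp (@mono k Qm (c + d)) 0 (unflat p) =
  oapp (mono c) 0 (unflat p) + oapp (mono d) 0 (unflat p).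
Proof. by case: unflat => [q|] /=; rewrite ?addr0 ?monoD. Qed.

Lemma power_projD a b : power_proj (a + b) = power_proj a + power_proj b.
Proof. by rewrite power_proj.unlock; apply: lextD. Qed.

Lemma power_proj0 : power_proj 0 = 0.
Proof. rewrite power_proj.unlock; exact: lext0. Qed.

Lemma power_proj_flat c p : power_proj (mono c (flat_path p)) = mono c p.
Proof. by rewrite power_proj.unlock lext_mono // flatK. Qed.

Lemma power_embK : cancel power_emb power_proj.
Proof.
apply: (pa_additive_eq (u := fun a => power_proj (power_emb a)) (v := id)) => [a b|//|c p].
  by rewrite power_embD power_projD.
by rewrite power_emb_mono power_proj_flat.
Qed.

Lemma power_projK d a : homogeneous (m * d)%N a -> power_emb (power_proj a) = a.
Proof.
apply: (homog_ind (P := fun a => power_emb (power_proj a) = a)) => [|c p pd|b c eb ec].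
- by rewrite power_proj0 power_emb0.
- have [|q <-] := @flat_path_surj Q m p; first by rewrite pd dvdn_mulr.
  by rewrite power_proj_flat power_emb_mono.
- by rewrite power_projD power_embD; apply: f_equal2 eb ec.
Qed.

Lemma homog_power_proj d a : homogeneous (m * d)%N a -> homogeneous d (power_proj a).
Proof.
elim/homog_ind: a / => [|c p pd|a b]; first by rewrite power_proj0; apply: homog0.
  have [|q eq] := @flat_path_surj Q m p; first by rewrite pd dvdn_mulr.
  rewrite -eq plength_flat in pd; move/eqP: pd; rewrite eqn_pmul2l // => /eqP <-.
  by rewrite -eq power_proj_flat; apply: homog_mono.
by rewrite power_projD; apply: homogD.
Qed.

Lemma power_proj_ndvd d a : ~~ (m %| d)%N -> homogeneous d a -> power_proj a = 0.
Proof.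
move=> md; elim/homog_ind: a / => [|c p pd|a b IHa IHb]; first exact: power_proj0.
  rewrite power_proj.unlock lext_mono // /unflat; case: pselect => // eq.
  by case/negP: md; case: eq => q eq; rewrite -pd -eq plength_flat dvdn_mulr.
by rewrite power_projD IHa IHb addr0.
Qed.

(** Linearity of psi over the path algebra of the power quiver. Composing with a concatenated path
    does not change the length modulo m, so both sides vanish unless m divides the length of [q];
    otherwise [q] is itself in the image of phi. *)
Lemma power_proj_emb a b : power_proj (power_emb a * b) = a * power_proj b.
Proof.
move: a b; apply: pa_biadditive_eq => [b a a'|a b b'|b a a'|a b b'|c p d q].
- by rewrite power_embD mulrDl power_projD.
- by rewrite mulrDr power_projD.
- by rewrite mulrDl.
- by rewrite power_projD mulrDr.
have [|nmq] := boolP (m %| plength q)%N.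
  by case/flat_path_surj => r <-; rewrite power_proj_flat -power_emb_mono -power_embM power_embK.
rewrite (power_proj_ndvd nmq (homog_mono d q)) mulr0.
rewrite power_emb_mono monoM; case e: pcomp => [r|] /=; last exact: power_proj0.
apply: (power_proj_ndvd _ (homog_mono _ r)).
by rewrite (plength_pcomp e) plength_flat dvdn_addl // dvdn_mulr.
Qed.

End PowerAlgebra.

(** * Finite sums of homogeneous elements *)

Section GradedSpan.
Variables (E : zmodType) (D : int -> E -> Prop).

(** Degrees may repeat in such a sum, which makes closure under addition immediate and gives an
    induction principle. *)
Inductive gspan : E -> Prop :=
| gspan0 : gspan 0
| gspanS i x y : D i x -> gspan y -> gspan (x + y).

Lemma gspan_in i x : D i x -> gspan x.
Proof. by move=> Dx; rewrite -[x]addr0; apply: gspanS Dx gspan0. Qed.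

Lemma gspanD x y : gspan x -> gspan y -> gspan (x + y).
Proof. by elim=> [|i x' y' Dx _ IH] sy; rewrite ?add0r // -addrA; apply: gspanS Dx (IH sy). Qed.

Lemma gspan_sum (s : seq int) (f : int -> E) :
  (forall i, D i (f i)) -> gspan (\sum_(i <- s) f i).
Proof.
move=> Df; apply: (big_ind gspan) => [||i _]; [exact: gspan0 | exact: gspanD |].
exact: gspan_in (Df i).
Qed.

Hypothesis D0 : forall i, D i 0.
Hypothesis DB : forall i x y, D i x -> D i y -> D i (x - y).

Lemma degN i x : D i x -> D i (- x).
Proof. by rewrite -sub0r; apply: DB. Qed.

Lemma degD i x y : D i x -> D i y -> D i (x + y).
Proof. by move=> Dx /degN /(DB Dx); rewrite opprK. Qed.

Lemma gspanN x : gspan x -> gspan (- x).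
Proof.
elim=> [|i y z Dy _ IH]; first by rewrite oppr0; apply: gspan0.
by rewrite opprD; apply: gspanS IH; apply: degN Dy.
Qed.

Lemma gspanB x y : gspan x -> gspan y -> gspan (x - y).
Proof. by move=> sx /gspanN; apply: gspanD. Qed.

(** Summands of equal degree are merged, giving the repetition-free index list that the directness
    axioms require. *)
Lemma gspan_indexed x : gspan x -> exists (s : seq int) (f : int -> E),
  [/\ uniq s, forall i, D i (f i) & x = \sum_(i <- s) f i].
Proof.
elim=> [|i y z Dy _ [s [f [us Df ->]]]].
  by exists [::], (fun=> 0); rewrite big_nil.
have [si|nsi] := boolP (i \in s).
  exists s, (fun j => if j == i then y + f i else f j); split=> // [j|].
    by case: eqP => [->|_] //; apply: degD.
  rewrite (bigD1_seq i) // [in RHS](bigD1_seq i) //= eqxx addrA; congr (_ + _).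
  by apply: eq_bigr => j /negbTE->.
exists (i :: s), (fun j => if j == i then y else f j); split=> [|j|].
- by rewrite /= nsi.
- by case: eqP => [->|_].
rewrite big_cons eqxx; congr (_ + _); rewrite !big_seq; apply: eq_bigr => j.
by case: eqP => [->|//]; rewrite (negbTE nsi).
Qed.

End GradedSpan.

Lemma gspan_map (E F : zmodType) (D : int -> E -> Prop) (D' : int -> F -> Prop)
    (g : E -> F) x :
  g 0 = 0 -> (forall x y, g (x + y) = g x + g y) ->
  (forall i x, D i x -> gspan D' (g x)) -> gspan D x -> gspan D' (g x).
Proof.
move=> g0 gD gdeg; elim=> [|i y z Dy _ IH]; first by rewrite g0; apply: gspan0.
by rewrite gD; apply: gspanD IH; apply: gdeg Dy.
Qed.

Section LinearOf.
Variables (R : pzRingType) (U V : lmodType R) (f : U -> V).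
Hypothesis f_linear : linear f.
(** Mentioning the proof in the body makes it an argument of this constant, so that the linear
    structure can be attached to the constant. *)
Definition linear_fun := let _ := f_linear in f.
HB.instance Definition _ := GRing.isLinear.Build R U V *:%R linear_fun f_linear.
Definition linear_of : {linear U -> V} := linear_fun.
End LinearOf.

(** * The graded module generated by independent homogeneous pieces *)

Section GradedPart.
Variables (k : fieldType) (Q : quiver).
Local Notation kQ := (path_algebra k Q).

(* A module with independent graded pieces that need not exhaust it. *)
Record pregrmod := PreGrMod {
  pgmod :> lmodType kQ;
  pdeg : int -> pgmod -> Prop;
  pdeg0 : forall i, pdeg i 0;
  pdegB : forall i x y, pdeg i x -> pdeg i y -> pdeg i (x - y);
  pdegZ : forall d i a x,
    homogeneous d a -> pdeg i x -> pdeg (d%:Z + i) (a *: x);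
  pdeg_direct : forall (s : seq int) (f : int -> pgmod), uniq s ->
    (forall i, pdeg i (f i)) -> \sum_(i <- s) f i = 0 ->
    forall i, i \in s -> f i = 0
}.

Lemma gspanZ (E : lmodType kQ) (D : int -> E -> Prop) (a : kQ) x :
  (forall c p i x, D i x -> gspan D (mono c p *: x)) ->
  gspan D x -> gspan D (a *: x).
Proof.
move=> DZ; elim=> [|i y z Dy _ IH]; first by rewrite scaler0; apply: gspan0.
rewrite scalerDr; apply: gspanD IH; elim/pa_ind: a => [|c p|a b IHa IHb].
- by rewrite scale0r; apply: gspan0.
- exact: DZ Dy.
- by rewrite scalerDl; apply: gspanD.
Qed.

Variable P : pregrmod.

(** The sum of the pieces, on which they do form a grading. Kernels, cokernels, Veronese modules and
    coinduced modules are all obtained in this way. *)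
Record grpart := GrPart { gval : P; gvalP : gspan (@pdeg P) gval }.

Lemma gval_inj : injective gval.
Proof.
by case=> x xP [y yP] /= exy; subst y; congr GrPart; apply: Prop_irrelevance.
Qed.

HB.instance Definition _ := gen_eqMixin grpart.
HB.instance Definition _ := gen_choiceMixin grpart.

Definition grpart0 : grpart := GrPart (gspan0 _).
Definition grpart_add (x y : grpart) : grpart := GrPart (gspanD (gvalP x) (gvalP y)).
Definition grpart_opp (x : grpart) : grpart :=
  GrPart (gspanN (@pdeg0 P) (@pdegB P) (gvalP x)).

Lemma grpart_scale_subproof a (x : grpart) : gspan (@pdeg P) (a *: gval x).
Proof.
apply: gspanZ (gvalP x) => c p i y Dy.
exact: gspan_in (pdegZ (homog_mono c p) Dy).
Qed.
Definition grpart_scale a (x : grpart) : grpart := GrPart (grpart_scale_subproof a x).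

Lemma grpart_addA : associative grpart_add.
Proof. by move=> x y z; apply/gval_inj/addrA. Qed.
Lemma grpart_addC : commutative grpart_add.
Proof. by move=> x y; apply/gval_inj/addrC. Qed.
Lemma grpart_add0 : left_id grpart0 grpart_add.
Proof. by move=> x; apply/gval_inj/add0r. Qed.
Lemma grpart_addN : left_inverse grpart0 grpart_opp grpart_add.
Proof. by move=> x; apply/gval_inj/addNr. Qed.
HB.instance Definition _ := GRing.isZmodule.Build grpart
  grpart_addA grpart_addC grpart_add0 grpart_addN.

Lemma grpart_scaleA a b x : grpart_scale a (grpart_scale b x) = grpart_scale (a * b) x.
Proof. exact/gval_inj/scalerA. Qed.
Lemma grpart_scale1 : left_id 1 grpart_scale.
Proof. by move=> x; apply/gval_inj/scale1r. Qed.
Lemma grpart_scaleDr : right_distributive grpart_scale +%R.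
Proof. by move=> a x y; apply/gval_inj/scalerDr. Qed.
Lemma grpart_scaleDl x : {morph grpart_scale^~ x : a b / a + b}.
Proof. by move=> a b; apply/gval_inj/scalerDl. Qed.
HB.instance Definition _ := GRing.Zmodule_isLmodule.Build kQ grpart
  grpart_scaleA grpart_scale1 grpart_scaleDr grpart_scaleDl.

Lemma gvalD x y : gval (x + y) = gval x + gval y. Proof. by []. Qed.
Lemma gval_sum I (s : seq I) (f : I -> grpart) :
  gval (\sum_(i <- s) f i) = \sum_(i <- s) gval (f i).
Proof. exact: (big_morph gval gvalD erefl). Qed.

Definition grpart_grmod : grmod k Q.
Proof.
apply: (@GrMod k Q grpart (fun i x => pdeg i (gval x))).
- by move=> i; apply: pdeg0.
- by move=> i x y; apply: pdegB.
- by move=> d i a x; apply: pdegZ.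
- move=> x; have [s [f [_ Df ex]]] := gspan_indexed (@pdeg0 P) (@pdegB P) (gvalP x).
  exists s, (fun i => GrPart (gspan_in (Df i))); split=> //.
  by apply: gval_inj; rewrite gval_sum.
- move=> s f us Df sf0 i si; apply: gval_inj.
  apply: (pdeg_direct us Df) si.
  by rewrite -gval_sum sf0.
Defined.

End GradedPart.

Arguments GrPart {k Q P gval}.

(** * Projections of a graded module onto sets of degrees *)

Section GradedModule.
Variables (k : fieldType) (Q : quiver) (M : grmod k Q).
Local Notation kQ := (path_algebra k Q).
Implicit Types (S : pred int) (x y : M).

Lemma gr_span x : gspan (@gdeg k Q M) x.
Proof. by have [s [f [Df ->]]] := gdeg_sum x; apply: gspan_sum. Qed.

Lemma gr_ind (P : M -> Prop) : P 0 -> (forall x y, P x -> P y -> P (x + y)) ->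
  (forall i x, gdeg i x -> P x) -> forall x, P x.
Proof.
move=> P0 PD Pdeg x; elim: (gr_span x) => // i y z Dy _ Pz.
by apply: PD Pz; apply: Pdeg Dy.
Qed.

(** The pieces of degree outside [S] are replaced by 0, so that [gspan (deg_in S)] is the sum of the
    components with degree in [S]. *)
Definition deg_in S i x := gdeg i x /\ (~~ S i -> x = 0).

Lemma deg_in0 S i : deg_in S i 0.
Proof. by split=> [|_]; first exact: (@gdeg0 _ _ M). Qed.

Lemma deg_inB S i x y : deg_in S i x -> deg_in S i y -> deg_in S i (x - y).
Proof.
move=> [Dx Sx] [Dy Sy]; split=> [|nS]; first exact: gdegB.
by rewrite Sx // Sy // subr0.
Qed.

(** Subtracting the two expansions of [z] over the union of their index sets gives a vanishing sum,
    so by directness they agree degree by degree. In each degree one of the two terms is 0. *)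
Lemma deg_in_disjoint S z :
  gspan (deg_in S) z -> gspan (deg_in (predC S)) z -> z = 0.
Proof.
case/(gspan_indexed (deg_in0 S) (@deg_inB S)) => s [f [us Df ef]].
case/(gspan_indexed (deg_in0 _) (@deg_inB _)) => t [g [ut Dg eg]].
pose u := undup (s ++ t).
have sumu (r : seq int) (h : int -> M) : uniq r -> {subset r <= u} ->
    \sum_(i <- r) h i = \sum_(i <- u) (if i \in r then h i else 0).
  move=> ur ru; rewrite -big_mkcond -big_filter; apply: perm_big.
  apply: uniq_perm => //; first by rewrite filter_uniq ?undup_uniq.
  by move=> i; rewrite mem_filter; case: (boolP (i \in r)) => // /ru->.
pose h i := (if i \in s then f i else 0) - (if i \in t then g i else 0).
have h0 i : i \in u -> h i = 0.
  apply: (@gdeg_direct k Q M) => [|j|]; first exact: undup_uniq.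
    apply: gdegB; case: ifP => _; do ?exact: gdeg0; first by case: (Df j).
    by case: (Dg j).
  rewrite /h big_split sumrN /= -!sumu // -?ef -?eg ?subrr //.
    by move=> j; rewrite mem_undup mem_cat orbC => ->.
  by move=> j; rewrite mem_undup mem_cat => ->.
rewrite ef big_seq big1 // => i si; have ui : i \in u by rewrite mem_undup mem_cat si.
have [Si|nSi] := boolP (S i); last by case: (Df i) => _ ->.
move: (h0 i ui); rewrite /h si; case: (Dg i) => _ /= -> //; last by rewrite negbK.
by rewrite if_same subr0.
Qed.

Lemma gproj_subproof S x :
  exists y, gspan (deg_in S) y /\ gspan (deg_in (predC S)) (x - y).
Proof.
elim/gr_ind: x => [|x x' [y [Sy Cy]] [y' [Sy' Cy']]|i x Dx].
- by exists 0; rewrite subr0; split; apply: gspan0.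
- by exists (y + y'); rewrite opprD addrACA; split; apply: gspanD.
- have [Si|nSi] := boolP (S i).
    exists x; rewrite subrr; split; last exact: gspan0.
    by apply: (@gspan_in _ _ i); split=> // /negP.
  exists 0; rewrite subr0; split; first exact: gspan0.
  by apply: (@gspan_in _ _ i); split=> //=; rewrite negbK => Si; rewrite Si in nSi.
Qed.

(** The choice is unique by [gproj_uniq]. With [pred1 i] it extracts one homogeneous component, with
    [mdvd m] the Veronese part. *)
Definition gproj S x : M := projT1 (cid (gproj_subproof S x)).

Lemma gproj_in S x : gspan (deg_in S) (gproj S x).
Proof. by rewrite /gproj; case: cid => y []. Qed.

Lemma gproj_out S x : gspan (deg_in (predC S)) (x - gproj S x).
Proof. by rewrite /gproj; case: cid => y []. Qed.

Lemma gproj_uniq S x y :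
  gspan (deg_in S) y -> gspan (deg_in (predC S)) (x - y) -> gproj S x = y.
Proof.
move=> Sy Cy; apply/eqP; rewrite -subr_eq0; apply/eqP; apply: (@deg_in_disjoint S).
  by apply: gspanB (gproj_in S x) Sy; [apply: deg_in0 | apply: deg_inB].
have -> : gproj S x - y = (x - y) - (x - gproj S x).
  by rewrite opprB [RHS]addrC subrKA.
by apply: gspanB Cy (gproj_out S x); [apply: deg_in0 | apply: deg_inB].
Qed.

Lemma gprojD S x y : gproj S (x + y) = gproj S x + gproj S y.
Proof.
apply: gproj_uniq; first by apply: gspanD; apply: gproj_in.
by rewrite opprD addrACA; apply: gspanD; apply: gproj_out.
Qed.

Lemma gproj0 S : gproj S 0 = 0.
Proof. by apply: gproj_uniq; rewrite ?subr0; apply: gspan0. Qed.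

Lemma gproj_sum S I (s : seq I) (f : I -> M) :
  gproj S (\sum_(i <- s) f i) = \sum_(i <- s) gproj S (f i).
Proof. exact: (big_morph _ (gprojD S) (gproj0 S)). Qed.

Lemma gproj_id S x : gspan (deg_in S) x -> gproj S x = x.
Proof. by move=> Sx; apply: gproj_uniq; rewrite ?subrr //; apply: gspan0. Qed.

Lemma gproj_deg S i x : gdeg i x -> S i -> gproj S x = x.
Proof.
move=> Dx Si; apply: gproj_id; apply: (@gspan_in _ _ i).
by split=> // /negP.
Qed.

Lemma gproj_deg0 S i x : gdeg i x -> ~~ S i -> gproj S x = 0.
Proof.
move=> Dx Si; apply: gproj_uniq; first exact: gspan0.
rewrite subr0; apply: (@gspan_in _ _ i); split=> //=.
by rewrite negbK => S'; rewrite S' in Si.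
Qed.

Lemma gproj_homog S S' d (a : kQ) x : homogeneous d a ->
  (forall i, S (d%:Z + i) = S' i) -> gproj S (a *: x) = a *: gproj S' x.
Proof.
move=> da SS'; elim/gr_ind: x => [|x y IHx IHy|i x Dx].
- by rewrite scaler0 !gproj0 scaler0.
- by rewrite scalerDr !gprojD IHx IHy scalerDr.
have Dax := gdegZ da Dx.
have [Si|nSi] := boolP (S' i).
  by rewrite (gproj_deg Dx Si) (gproj_deg Dax) // SS'.
by rewrite (gproj_deg0 Dx nSi) (gproj_deg0 Dax) ?SS' // scaler0.
Qed.

End GradedModule.

Lemma gproj_grhom (k : fieldType) (Q : quiver) (M N : grmod k Q) (f : grhom M N) S x :
  gproj S (f x) = f (gproj S x).
Proof.
elim/gr_ind: x => [|x y IHx IHy|i x Dx].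
- by rewrite gproj0 !linear0 gproj0.
- by rewrite linearD !gprojD IHx IHy linearD.
have [Si|nSi] := boolP (S i).
  by rewrite (gproj_deg Dx Si) (gproj_deg (glin_deg f Dx) Si).
by rewrite (gproj_deg0 Dx nSi) (gproj_deg0 (glin_deg f Dx) nSi) linear0.
Qed.

(** * Quotient modules *)

Record submodule (R : pzRingType) (E : lmodType R) := Submodule {
  insub_mod :> E -> Prop;
  insub_mod0 : insub_mod 0;
  insub_modZD : forall a x y, insub_mod x -> insub_mod y -> insub_mod (a *: x + y)
}.

Section QuotientModule.
Variables (R : pzRingType) (E : lmodType R) (P : submodule E).

Let P0 : P 0. Proof. exact: insub_mod0. Qed.

Let PD x y : P x -> P y -> P (x + y).
Proof. by move=> Px Py; rewrite -[x]scale1r; apply: insub_modZD. Qed.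

Let PZ a x : P x -> P (a *: x).
Proof. by move=> Px; rewrite -[_ *: _]addr0; apply: insub_modZD. Qed.

Let PN x : P x -> P (- x).
Proof. by rewrite -scaleN1r; apply: PZ. Qed.

(** A canonical representative of the class of [x]: congruent elements define the same predicate,
    and the result of [choose] does not depend on which witness of it is supplied. The quotient is
    then the type of canonical representatives. *)
Definition qrep x : E := choose (fun y => `[< P (x - y) >]) x.

Lemma qrepP x : P (x - qrep x).
Proof. by apply/asboolP/(@chooseP _ (fun y => `[< P (x - y) >])); rewrite subrr; apply/asboolP. Qed.

Lemma eq_qrep x y : P (x - y) -> qrep x = qrep y.
Proof.
move=> Pxy; rewrite /qrep.
have PC z : `[< P (x - z) >] = `[< P (y - z) >].
  apply/asboolP/asboolP => Pz.
    have -> : y - z = (x - z) - (x - y) by rewrite opprB [RHS]addrC subrKA.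
    by apply: PD Pz (PN Pxy).
  by rewrite -(subrKA y); apply: PD.
rewrite (eq_choose PC); apply: choose_id; last by rewrite subrr; apply/asboolP.
by rewrite -PC subrr; apply/asboolP.
Qed.

Record quotmod := QuotMod { qval : E; qvalP : qrep qval = qval }.

Lemma qval_inj : injective qval.
Proof. by case=> x xP [y yP] /= exy; subst y; congr QuotMod; apply: Prop_irrelevance. Qed.

Lemma qrepK x : qrep (qrep x) = qrep x.
Proof. by apply/esym/eq_qrep/qrepP. Qed.

Definition qpi x := QuotMod (qrepK x).

Lemma qvalK : cancel qval qpi.
Proof. by move=> a; apply/qval_inj/qvalP. Qed.

Lemma qpiP x y : qpi x = qpi y <-> P (x - y).
Proof.
split=> [/(congr1 qval) /= e|/eq_qrep e]; last exact/qval_inj.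
rewrite -(subrKA (qrep x)) {2}e -[qrep y - y]opprB.
by apply: PD (qrepP x) (PN (qrepP y)).
Qed.

HB.instance Definition _ := gen_eqMixin quotmod.
HB.instance Definition _ := gen_choiceMixin quotmod.

Definition quot_add a b := qpi (qval a + qval b).
Definition quot_opp a := qpi (- qval a).
Definition quot_scale (c : R) a := qpi (c *: qval a).

Lemma qpi_add x y : quot_add (qpi x) (qpi y) = qpi (x + y).
Proof.
by apply/qpiP; rewrite /= -opprB (opprD (qrep x)) addrACA; apply/PN/PD; apply: qrepP.
Qed.

Lemma qpi_opp x : quot_opp (qpi x) = qpi (- x).
Proof. by apply/qpiP; rewrite opprK addrC; apply: qrepP. Qed.

Lemma qpi_scale c x : quot_scale c (qpi x) = qpi (c *: x).
Proof. by apply/qpiP; rewrite -scalerBr; apply/PZ; rewrite -opprB; apply/PN/qrepP. Qed.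

Lemma quot_addA : associative quot_add.
Proof.
by move=> a b c; rewrite -(qvalK a) -(qvalK b) -(qvalK c) !qpi_add addrA.
Qed.
Lemma quot_addC : commutative quot_add.
Proof. by move=> a b; rewrite /quot_add addrC. Qed.
Lemma quot_add0 : left_id (qpi 0) quot_add.
Proof. by move=> a; rewrite -(qvalK a) qpi_add add0r. Qed.
Lemma quot_addN : left_inverse (qpi 0) quot_opp quot_add.
Proof. by move=> a; rewrite -(qvalK a) qpi_opp qpi_add addNr. Qed.
HB.instance Definition _ := GRing.isZmodule.Build quotmod
  quot_addA quot_addC quot_add0 quot_addN.

Lemma quot_scaleA c d a : quot_scale c (quot_scale d a) = quot_scale (c * d) a.
Proof. by rewrite -(qvalK a) !qpi_scale scalerA. Qed.
Lemma quot_scale1 : left_id 1 quot_scale.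
Proof. by move=> a; rewrite -(qvalK a) qpi_scale scale1r. Qed.
Lemma quot_scaleDr : right_distributive quot_scale +%R.
Proof.
move=> c a b; rewrite -(qvalK a) -(qvalK b).
by rewrite [LHS](congr1 _ (qpi_add _ _)) !qpi_scale [RHS]qpi_add scalerDr.
Qed.
Lemma quot_scaleDl a : {morph quot_scale^~ a : c d / c + d}.
Proof.
by move=> c d; rewrite -(qvalK a) !qpi_scale [RHS]qpi_add scalerDl.
Qed.
HB.instance Definition _ := GRing.Zmodule_isLmodule.Build R quotmod
  quot_scaleA quot_scale1 quot_scaleDr quot_scaleDl.

Lemma qpiD x y : qpi (x + y) = qpi x + qpi y.
Proof. by rewrite [RHS]qpi_add. Qed.

Lemma qpiZ c x : qpi (c *: x) = c *: qpi x.
Proof. by rewrite [RHS]qpi_scale. Qed.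

Lemma qpi_linear : linear qpi.
Proof. by move=> c x y; rewrite qpiD qpiZ. Qed.

Lemma qpi_eq0 x : qpi x = 0 <-> P x.
Proof. by rewrite -[x in P x]subr0; apply: qpiP. Qed.

End QuotientModule.

(** * Membership in Fdim as torsion under long paths *)

Section Torsion.
Variables (k : fieldType) (Q : quiver).
Local Notation kQ := (path_algebra k Q).

(** For N = 0 this says that [x] is torsion; for N the image of a morphism, that the class of [x] in
    the cokernel is torsion. *)
Definition eventually_in (M : grmod k Q) (N : M -> Prop) (x : M) : Prop :=
  exists n : nat, forall p : qpath Q, (n <= plength p)%N -> N (mono 1 p *: x).

Lemma eventually_in0 (M : grmod k Q) (N : M -> Prop) : N 0 -> eventually_in N 0.
Proof. by exists 0%N => p _; rewrite scaler0. Qed.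

Lemma eventually_inD (M : grmod k Q) (N : M -> Prop) (x y : M) :
  (forall x y, N x -> N y -> N (x + y)) ->
  eventually_in N x -> eventually_in N y -> eventually_in N (x + y).
Proof.
move=> ND [n nx] [l ly]; exists (maxn n l) => p.
rewrite geq_max => /andP[np lp]; rewrite scalerDr.
by apply: ND; [apply: nx | apply: ly].
Qed.

Lemma deg_in_bounded (M : grmod k Q) (x : M) :
  exists B : int, forall C, (B <= C)%R -> gspan (deg_in (fun i => (i < C)%R)) x.
Proof.
elim/gr_ind: x => [|x y [B Bx] [C Cy]|i x Dx].
- by exists 0 => C _; apply: gspan0.
- exists (Num.max B C) => A; rewrite Order.TotalTheory.ge_max => /andP[BA CA].
  by apply: gspanD; [apply: Bx | apply: Cy].
- exists (i + 1) => C iC; apply: (@gspan_in _ _ i); split=> //.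
  by rewrite (_ : (i < C)%R) //; lia.
Qed.

(** A finite-dimensional submodule has no component in large degrees, while a path raises degrees by
    its length. *)
Lemma Fdim_torsion (M : grmod k Q) : Fdim M ->
  forall x : M, eventually_in (fun y => y = 0) x.
Proof.
move=> FM x; have [s [-> sN]] := FM x.
have T0 : eventually_in (fun y : M => y = 0) 0 by apply: eventually_in0.
have TD y z : eventually_in (fun y : M => y = 0) y -> eventually_in (fun y : M => y = 0) z ->
    eventually_in (fun y : M => y = 0) (y + z).
  by apply: eventually_inD => ? ? -> ->; rewrite addr0.
rewrite big_seq; apply: big_ind => // y /sN[N [[N0 NZ Ngr] [b [bN Nb]] Ny]].
(* A finite spanning family has bounded degrees and scalars from k preserve degrees, so one bound
   serves all of [N]. *)
have [B NB] : exists B : int, forall z, N z -> gspan (deg_in (fun i => (i < B)%R)) z.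
  have [B bB] : exists B : int, forall w, w \in b -> gspan (deg_in (fun i => (i < B)%R)) w.
    elim: (b) => [|w b' [B IH]]; first by exists 0.
    have [C Cw] := deg_in_bounded w.
    exists (Num.max B C) => v; rewrite inE => /orP[/eqP ->|/IH vB].
      by apply: Cw; rewrite Order.TotalTheory.le_max Order.POrderTheory.lexx orbT.
    elim: vB => [|i u u' [Du Su] _ IHu]; first exact: gspan0.
    apply: gspanS IHu; split; first exact: Du.
    by move=> nS; apply: Su; apply: contra nS; rewrite Order.TotalTheory.lt_max => ->.
  exists B => z /Nb[c ->]; rewrite big_seq.
  apply: big_ind => [||w /bB wB]; [exact: gspan0 | by move=> ? ?; apply: gspanD |].
  rewrite -kscalE; apply: gspan_map wB; [exact: scaler0 | exact: scalerDr |].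
  move=> i u [Du Su]; apply: (@gspan_in _ _ i); split.
    by rewrite -[i]add0r; apply: (gdegZ (@homog_kscal k Q (c w)) Du).
  by move/Su->; rewrite scaler0.
have [t [f [fN ->]]] := Ngr y Ny.
apply: big_ind => // i _; have [Df Nf] := fN i.
(* Such a path moves degree [i] to [B] or beyond. The result lies in [N], hence below [B], and also
   in a degree not below [B], so it is 0. *)
exists `|B - i|%N => p np; apply: (@deg_in_disjoint _ _ _ (fun i => (i < B)%R)).
  by apply: NB; rewrite -[_ *: _]addr0; apply: NZ.
apply: (@gspan_in _ _ ((plength p)%:Z + i)); split.
  exact: gdegZ (homog_mono 1 p) Df.
by rewrite /= negbK => lt; exfalso; lia.
Qed.

Definition short_paths n : seq (qpath Q) :=
  flatten [seq [seq qpath_of_length x | x <- enum {: path_of_length Q r}] | r <- iota 0 n].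

Lemma mem_short_paths n p : (plength p < n)%N -> p \in short_paths n.
Proof.
move=> pn; apply/flattenP.
  exists [seq qpath_of_length x | x <- enum {: path_of_length Q (plength p)}].
  by apply/mapP; exists (plength p); rewrite // mem_iota.
have wp : is_walk (psource p, in_tuple (parrows p)).1 (psource p, in_tuple (parrows p)).2.
  exact: (valP p).
apply/mapP; exists (exist _ (psource p, in_tuple (parrows p)) wp); first by rewrite mem_enum.
by apply: val_inj; rewrite /= [LHS]surjective_pairing.
Qed.

(** Each homogeneous [y] generates a graded submodule kQ y. If paths of length at least n kill [y],
    it is spanned over k by the multiples of [y] by shorter paths, which are finitely many since Q
    is finite. *)
Lemma torsion_Fdim (M : grmod k Q) :
  (forall x : M, eventually_in (fun y => y = 0) x) -> Fdim M.
Proof.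
move=> TM x; have [s [f [Df ->]]] := gdeg_sum x.
exists (map f s); split; first by rewrite big_map.
move=> _ /mapP[i _ ->]; move: (f i) (Df i) => {x s f Df} y Dy.
exists (fun z => exists a : kQ, z = a *: y); split; last by exists 1; rewrite scale1r.
  split; first by exists 0; rewrite scale0r.
    by move=> a _ _ [b ->] [c ->]; exists (a * b + c); rewrite scalerDl scalerA.
  move=> _ [a ->].
  have : gspan (fun j z => gdeg j z /\ exists a : kQ, z = a *: y) (a *: y).
    elim/pa_ind: a => [|c p|a b IHa IHb].
    - by rewrite scale0r; apply: gspan0.
    - apply: (@gspan_in _ _ ((plength p)%:Z + i)); split; last by exists (mono c p).
      exact: gdegZ (homog_mono c p) Dy.
    - by rewrite scalerDl; apply: gspanD.
  case/gspan_indexed => [j|j u v [Du [b eb]] [Dv [c ec]]|t [g [_ Dg ->]]].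
  - by split; [apply: gdeg0 | exists 0; rewrite scale0r].
  - by split; [apply: gdegB | exists (b - c); rewrite eb ec scalerBl].
  - by exists t, g.
have [n ny] := TM y.
(* Coefficients in [findim] are indexed by elements, and different paths may send [y] to the same
   element; without repetitions each is counted once. *)
pose b := undup [seq mono 1 p *: y | p <- short_paths n].
exists b; split.
  by move=> z; rewrite mem_undup => /mapP[p _ ->]; exists (mono 1 p).
move=> _ [a ->].
elim/pa_ind: a => [|c p|a a' [c IHc] [c' IHc']].
- exists (fun=> 0); rewrite scale0r big1 // => z _.
  by rewrite -kscalE kscal0 scale0r.
- rewrite monoE -scalerA; have [np|pn] := leqP n (plength p).
    rewrite ny // scaler0; exists (fun=> 0); rewrite big1 // => z _.
    by rewrite -kscalE kscal0 scale0r.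
  exists (fun z => if z == mono 1 p *: y then c else 0).
  rewrite (bigD1_seq (mono 1 p *: y)) ?undup_uniq //=; last first.
    by rewrite mem_undup; apply: map_f; apply: mem_short_paths.
  rewrite eqxx -kscalE big1 ?addr0 // => z /negbTE ->.
  by rewrite -kscalE kscal0 scale0r.
- exists (fun z => c z + c' z); rewrite scalerDl IHc IHc' -big_split.
  by apply: eq_bigr => z _; rewrite -!kscalE kscalD scalerDl.
Qed.

(** * Kernels, cokernels and a criterion for the inverted morphisms *)

Section KernelCokernel.
Variables (M N : grmod k Q) (f : grhom M N).

(** The ambient module is all of [M]; only the pieces are restricted. They span exactly the kernel,
    by [gspan_ker] and [gval_ker]. *)
Definition ker_pregrmod : pregrmod k Q.
Proof.
apply: (@PreGrMod k Q M (fun i x => gdeg i x /\ f x = 0)).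
- by move=> i; split; [apply: gdeg0 | rewrite linear0].
- move=> i x y [Dx fx] [Dy fy]; split; first exact: gdegB.
  by rewrite linearB fx fy subr0.
- move=> d i a x da [Dx fx]; split; first exact: gdegZ.
  by rewrite linearZ_LR fx scaler0.
- move=> s g us Dg; apply: gdeg_direct us _ => i.
  by case: (Dg i).
Defined.

Definition ker_grmod := grpart_grmod ker_pregrmod.

Lemma gval_ker_linear : linear (fun x : ker_grmod => gval x : M).
Proof. by []. Qed.

Definition ker_incl : grhom ker_grmod M.
Proof.
by apply: (@GrHom k Q ker_grmod M (linear_of gval_ker_linear)) => i x [].
Defined.

(** As [f] preserves degrees and the grading of [N] is direct, each homogeneous component of [x] is
    killed separately. *)
Lemma gspan_ker x : f x = 0 -> gspan (@pdeg k Q ker_pregrmod) x.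
Proof.
have [s [g [us Dg ->]]] := gspan_indexed (@gdeg0 k Q M) (@gdegB k Q M) (gr_span x).
rewrite linear_sum => fg0; rewrite big_seq.
apply: big_ind => [||i si]; [exact: gspan0 | by move=> ? ?; apply: gspanD |].
apply: (@gspan_in _ _ i); split=> //.
by apply: (gdeg_direct us _ fg0) => // j; apply: glin_deg.
Qed.

Lemma gval_ker (x : ker_grmod) : f (gval x) = 0.
Proof.
elim: (gvalP x) => [|i y z [_ fy] _ fz]; first exact: linear0.
by rewrite linearD fy fz addr0.
Qed.

Definition im_submodule : submodule N.
Proof.
exists (fun y => exists x, y = f x); first by exists 0; rewrite linear0.
by move=> a x y [u ->] [v ->]; exists (a *: u + v); rewrite linearP.
Defined.

Definition coker_pregrmod : pregrmod k Q.
Proof.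
apply: (@PreGrMod k Q (quotmod im_submodule)
  (fun i z => exists2 y, gdeg i y & z = qpi im_submodule y)).
- by move=> i; exists 0; [apply: gdeg0|].
- move=> i _ _ [x Dx ->] [y Dy ->]; exists (x - y); first exact: gdegB.
  by rewrite -!scaleN1r qpiD qpiZ.
- by move=> d i a _ da [x Dx ->]; exists (a *: x); [apply: gdegZ | rewrite qpiZ].
- move=> s h us Dh.
  have /boolp.choice[g gP] : forall i, exists y, gdeg i y /\ h i = qpi im_submodule y.
    by move=> i; case: (Dh i) => y Dy ->; exists y.
  rewrite (eq_bigr (fun i => qpi im_submodule (g i))) => [|i _]; last by case: (gP i).
  rewrite -(big_morph _ (qpiD im_submodule) (erefl : qpi im_submodule 0 = 0)).
  move/qpi_eq0 => [x ex] i si; case: (gP i) => Dg ->; apply/qpi_eq0.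
  (* The homogeneous representatives [g i] sum to [f x]; taking components of degree [i] shows that
     [g i] is the image of the component of [x]. *)
  exists (gproj (pred1 i) x); rewrite -gproj_grhom -ex gproj_sum.
  rewrite (bigD1_seq i) //= (gproj_deg Dg) //= big1 ?addr0 // => j ji.
  by case: (gP j) => Dj _; apply: (gproj_deg0 Dj).
Defined.

Definition coker_grmod := grpart_grmod coker_pregrmod.

Lemma gspan_coker y : gspan (@pdeg k Q coker_pregrmod) (qpi im_submodule y).
Proof.
apply: gspan_map (gr_span y); [by [] | exact: qpiD |].
by move=> i x Dx; apply: (@gspan_in _ _ i); exists x.
Qed.

Definition to_coker y : coker_grmod := GrPart (gspan_coker y).

Lemma to_coker_linear : linear to_coker.
Proof. by move=> a x y; apply: gval_inj; apply: qpi_linear. Qed.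

Definition coker_proj : grhom N coker_grmod.
Proof.
by apply: (@GrHom k Q N coker_grmod (linear_of to_coker_linear)) => i x Dx; exists x.
Defined.

Lemma to_coker_eq0 y : to_coker y = 0 <-> exists x, y = f x.
Proof.
split=> [/(congr1 (@gval _ _ _))/qpi_eq0 //|yx].
by apply: gval_inj; apply/qpi_eq0.
Qed.

Lemma to_coker_surj z : exists y, z = to_coker y.
Proof.
exists (qval (gval z)); apply: gval_inj.
exact/esym/qvalK.
Qed.

(** One direction transports torsion along the given [i] and [p]; the other supplies the kernel and
    cokernel constructed above. *)
Lemma Fdim_isoP : Fdim_iso (f : @hom (Gr k Q) M N) <->
  (forall x, f x = 0 -> eventually_in (fun y => y = 0) x) /\
  (forall y, eventually_in (fun z => exists x, z = f x) y).
Proof.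
split=> [[K [C [i [p [FK FC [i_inj iP] [p_surj pP]]]]]]|[kerT cokT]].
  split=> [x /iP[z ->]|y].
    have [n nz] := Fdim_torsion FK z; exists n => q /nz.
    by rewrite -linearZ_LR => ->; rewrite linear0.
  have [n ny] := Fdim_torsion FC (p y); exists n => q /ny.
  by rewrite -linearZ_LR => /pP.
exists ker_grmod, coker_grmod, ker_incl, coker_proj; split.
- apply: torsion_Fdim => x.
  have [n nx] := kerT _ (gval_ker x); exists n => q /nx qx.
  exact: gval_inj.
- apply: torsion_Fdim => z; have [y ->] := to_coker_surj z.
  have [n ny] := cokT y; exists n => q /ny/to_coker_eq0.
  by rewrite -[to_coker]/(coker_proj : N -> coker_grmod) linearZ_LR.
- split; first exact: gval_inj.
  move=> x; split=> [fx|[z ->]]; first by exists (GrPart (gspan_ker fx)).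
  exact: gval_ker.
- by split; [exact: to_coker_surj | exact: to_coker_eq0].
Qed.

End KernelCokernel.
End Torsion.

(** * Restriction of scalars along phi *)

(** An alias of [M], so that the same group can carry a second scalar action. *)
Definition restriction (k : fieldType) (Q : quiver) (m : nat)
  (M : lmodType (path_algebra k Q)) : Type := M.

Section Restriction.
Variables (k : fieldType) (Q : quiver) (m : nat) (M : lmodType (path_algebra k Q)).
Local Notation kQm := (path_algebra k (quiver_power Q m)).

HB.instance Definition _ := GRing.Zmodule.on (restriction m M).

Definition restr_scale (a : kQm) (x : restriction m M) : restriction m M :=
  power_emb a *: (x : M).

Lemma restr_scaleA a b x : restr_scale a (restr_scale b x) = restr_scale (a * b) x.
Proof. by rewrite /restr_scale scalerA power_embM. Qed.
Lemma restr_scale1 : left_id 1 restr_scale.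
Proof. by move=> x; rewrite /restr_scale power_emb1 scale1r. Qed.
Lemma restr_scaleDr : right_distributive restr_scale +%R.
Proof. by move=> a x y; apply: scalerDr. Qed.
Lemma restr_scaleDl x : {morph restr_scale^~ x : a b / a + b}.
Proof. by move=> a b; rewrite /restr_scale power_embD; apply: scalerDl. Qed.
HB.instance Definition _ := GRing.Zmodule_isLmodule.Build kQm (restriction m M)
  restr_scaleA restr_scale1 restr_scaleDr restr_scaleDl.

End Restriction.

(** * The Veronese functor preserves and reflects the inverted morphisms *)

Section Veronese.
Variables (k : fieldType) (Q : quiver) (m : nat).
Hypothesis m_gt0 : (0 < m)%N.
Local Notation Qm := (quiver_power Q m).
Local Notation kQ := (path_algebra k Q).
Local Notation kQm := (path_algebra k Qm).

Lemma mulz_inj : injective (fun i : int => m%:Z * i).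
Proof. by move=> i j /= /mulfI; apply; lia. Qed.

Definition veronese_pregrmod (M : grmod k Q) : pregrmod k Qm.
Proof.
apply: (@PreGrMod k Qm (restriction m M) (fun i x => @gdeg k Q M (m%:Z * i) x)).
- by move=> i; apply: (@gdeg0 k Q M).
- by move=> i x y; apply: (@gdegB k Q M).
- move=> d i a x da; rewrite mulrDr -PoszM.
  by apply: (@gdegZ k Q M); apply: homog_power_emb.
- move=> s f us Df f0 i si.
  (* As m is positive, distinct indices give distinct degrees of [M], so projecting onto degree
     [m i] isolates [f i]. *)
  have := gproj_sum (M := M) (pred1 (m%:Z * i)) s f.
  rewrite [X in gproj _ X]f0 gproj0 (bigD1_seq i) //= (gproj_deg (Df i)) /= ?eqxx //.
  rewrite big1 ?addr0 // => j ji; apply: (gproj_deg0 (Df j)).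
  by rewrite /= (inj_eq mulz_inj).
Defined.

Definition veronese (M : grmod k Q) : grmod k Qm := grpart_grmod (veronese_pregrmod M).

Definition vval (M : grmod k Q) (x : veronese M) : M := gval x.

Lemma vval_inj (M : grmod k Q) : injective (@vval M).
Proof. exact: gval_inj. Qed.

Lemma vvalD (M : grmod k Q) (x y : veronese M) : vval (x + y) = vval x + vval y.
Proof. by []. Qed.

Lemma vvalZ (M : grmod k Q) (a : kQm) (x : veronese M) :
  vval (a *: x) = power_emb a *: vval x.
Proof. by []. Qed.

Section VeroneseMorphism.
Variables (M N : grmod k Q) (f : grhom M N).

Lemma veronese_mor_subproof (x : veronese M) :
  gspan (@pdeg k Qm (veronese_pregrmod N)) (f (vval x)).
Proof.
apply: (gspan_map (g := (f : M -> N))) (gvalP x); [exact: linear0 | exact: linearD |].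
by move=> i y Dy; apply: (@gspan_in _ _ i); apply: glin_deg.
Qed.

Definition veronese_fun (x : veronese M) : veronese N := GrPart (veronese_mor_subproof x).

Lemma veronese_linear : linear veronese_fun.
Proof. by move=> a x y; apply: vval_inj; apply: (linearP f). Qed.

Definition veronese_mor : grhom (veronese M) (veronese N) :=
  @GrHom k Qm (veronese M) (veronese N) (linear_of veronese_linear)
    (fun i x => @glin_deg k Q M N f (m%:Z * i) (vval x)).

Lemma vval_mor x : vval (veronese_mor x) = f (vval x).
Proof. by []. Qed.

End VeroneseMorphism.

Definition veronese_functor : functor (Gr k Q) (Gr k Qm).
Proof.
apply: (@Functor (Gr k Q) (Gr k Qm) veronese veronese_mor).
- by move=> M N f g fg x; apply: vval_inj; apply: fg.
- by move=> M x; apply: vval_inj.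
- by move=> M N P g f x; apply: vval_inj.
Defined.

Definition mdvd : pred int := fun i => `[< exists j, i = m%:Z * j >].

Lemma mdvdM j : mdvd (m%:Z * j).
Proof. by apply/asboolP; exists j. Qed.

Lemma mdvdD j i : mdvd (m%:Z * j + i) = mdvd i.
Proof.
apply/asboolP/asboolP => -[l e]; last by exists (j + l); rewrite e mulrDr.
by exists (l - j); rewrite mulrBr -e addrAC subrr add0r.
Qed.

Section VeroneseProjection.
Variable M : grmod k Q.

Lemma vproj_subproof (x : M) :
  gspan (@pdeg k Qm (veronese_pregrmod M)) (gproj mdvd x).
Proof.
elim: (gproj_in mdvd x) => [|i y z [Dy Sy] _ IH]; first exact: gspan0.
apply: (gspanD _ IH); have [/asboolP[j ej]|ni] := boolP (mdvd i).
  by apply: (@gspan_in _ _ j); move: Dy; rewrite ej.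
by rewrite Sy //; apply: gspan0.
Qed.

Definition vproj (x : M) : veronese M := GrPart (vproj_subproof x).

Lemma vval_proj x : vval (vproj x) = gproj mdvd x.
Proof. by []. Qed.

Lemma vprojD x y : vproj (x + y) = vproj x + vproj y.
Proof. by apply: vval_inj; apply: gprojD. Qed.

(** Concatenated paths shift degrees by multiples of m, so they respect the splitting into degrees
    divisible by m and the others. *)
Lemma vprojZ (c : kQm) x : vproj (power_emb c *: x) = c *: vproj x.
Proof.
apply: vval_inj; rewrite vvalZ !vval_proj.
elim/pa_ind: c => [|c p|a b IHa IHb].
- by rewrite power_emb0 !scale0r gproj0.
- rewrite power_emb_mono; apply: gproj_homog (homog_mono _ _) _ => i.
  by rewrite plength_flat PoszM mdvdD.
- by rewrite power_embD !scalerDl gprojD IHa IHb.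
Qed.

Lemma vvalK : cancel (@vval M) vproj.
Proof.
move=> x; apply: vval_inj; rewrite vval_proj; apply: gproj_id.
apply: (gspan_map (g := fun x : M => x)) (gvalP x) => // i y Dy.
apply: (@gspan_in _ _ (m%:Z * i)); split=> //.
by rewrite mdvdM.
Qed.

End VeroneseProjection.

Section VeroneseIso.
Variables (M N : grmod k Q) (f : grhom M N).

(** A path of the power quiver becomes at least as long when concatenated in Q, so the bounds for
    [f] remain valid. *)
Lemma Fdim_iso_veronese : Fdim_iso (f : @hom (Gr k Q) M N) ->
  Fdim_iso (veronese_mor f : @hom (Gr k Qm) _ _).
Proof.
case/Fdim_isoP => kerT cokT; apply/Fdim_isoP; split=> [x fx0|y].
  have [n nx] := kerT _ (congr1 (@vval N) fx0); exists n => p np.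
  apply: vval_inj; rewrite vvalZ power_emb_mono; apply: nx.
  by rewrite plength_flat; apply: leq_trans np _; apply: leq_pmull.
have [n ny] := cokT (vval y); exists n => p np.
have [|x ex] := ny (flat_path p).
  by rewrite plength_flat; apply: leq_trans np _; apply: leq_pmull.
(* The preimage found in [M] may have components outside V(M); [f] commutes with the projection, so
   discarding them keeps it a preimage. *)
exists (vproj x); apply: vval_inj; rewrite vval_mor vval_proj -gproj_grhom -ex.
by rewrite -power_emb_mono -vvalZ -vval_proj vvalK.
Qed.

Lemma path_split n (p : qpath Q) : (n <= plength p)%N -> exists p1 p2,
  [/\ mono (1 : k) p = mono 1 p2 * mono 1 p1, plength p1 = n
    & plength p2 = (plength p - n)%N].
Proof.
move=> np; have wp : is_walk (psource p) (parrows p) := valP p.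
rewrite -[parrows p](cat_take_drop n) is_walk_cat in wp.
have /andP[w1 w2] := wp.
pose p1 : qpath Q := @QPath Q (psource p, take n (parrows p)) w1.
pose p2 : qpath Q := @QPath Q (ptarget p1, drop n (parrows p)) w2.
exists p1, p2; split; last by rewrite /plength size_drop.
  rewrite monoM mulr1 /pcomp eqxx; case: insubP => [r _ er|] /=.
    congr mono; apply: val_inj; rewrite er [LHS]surjective_pairing.
    by rewrite cat_take_drop.
  by rewrite cat_take_drop (valP p).
by rewrite /plength size_takel.
Qed.

(** Passes from long paths of the power quiver to long paths of Q. A long path is an initial segment
    of length r that moves [y] into V(M), then a long concatenated path that reaches [N'], then a
    rest under which [N'] is stable. *)
Lemma eventually_veronese (N' : M -> Prop) (i : int) (y : M) :
  (forall (a : kQ) x, N' x -> N' (a *: x)) -> gdeg i y ->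
  (forall a (z : veronese M), vval z = a *: y ->
     eventually_in (fun w => N' (vval w)) z) ->
  eventually_in N' y.
Proof.
move=> NZ Dy NV.
(* Here [r] is the remainder of [- i] modulo m. *)
have [r [j ri]] : exists (r : nat), exists j, r%:Z + i = m%:Z * j.
  have := divz_eq (- i) m%:Z; have : 0 <= (- i %% m%:Z)%Z by rewrite modz_ge0 //; lia.
  case: (- i %% m%:Z)%Z => // r _ e; exists r, (- (- i %/ m%:Z)%Z).
  by move: (- i %/ m%:Z)%Z e => q e; nia.
(* After an initial segment [p] of length [r] the hypothesis applies, with a bound depending on
   [p]. *)
have [b bP] : exists b : qpath Q -> nat, forall p, plength p = r ->
    forall q : qpath Qm, (b p <= plength q)%N ->
    N' (mono 1 (flat_path q) *: (mono 1 p *: y)).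
  suff /boolp.choice[b bP] : forall p : qpath Q, exists n : nat, plength p = r ->
      forall q : qpath Qm, (n <= plength q)%N ->
      N' (mono 1 (flat_path q) *: (mono 1 p *: y)) by exists b.
  move=> p; have [pr|npr] := eqVneq (plength p) r; last first.
    by exists 0%N => pr; rewrite pr eqxx in npr.
  have Dpy : gdeg (m%:Z * j) (mono 1 p *: y).
    by rewrite -ri -pr; apply: gdegZ (homog_mono 1 p) Dy.
  have [|n nz] := NV (mono 1 p) (vproj (mono 1 p *: y)).
    by rewrite vval_proj (gproj_deg Dpy) // mdvdM.
  exists n => _ q /nz; rewrite vvalZ power_emb_mono vval_proj (gproj_deg Dpy) //.
  exact: mdvdM.
(* There are finitely many initial segments, so one bound serves them all; [r.+1] because
   [short_paths] lists the strictly shorter paths. *)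
pose B := (\max_(p <- short_paths Q r.+1) b p)%N.
exists (r + m * B)%N => p rp.
(* Cut the path into [p1] of length [r], then [p3] of length [m * B], which is the concatenation of
   a path [q] of length [B], then [p4]. *)
have [|p1 [p2 [-> p1r p2r]]] := @path_split r p; first by apply: leq_trans rp; apply: leq_addr.
have [|p3 [p4 [-> p3r p4r]]] := @path_split (m * B)%N p2; first by rewrite p2r; lia.
have [|q eq] := @flat_path_surj Q m p3; first by rewrite p3r dvdn_mulr.
rewrite -!scalerA; apply: NZ; rewrite -eq; apply: bP => //.
move: p3r; rewrite -eq plength_flat => /eqP; rewrite eqn_pmul2l // => /eqP ->.
by apply: leq_bigmax_seq => //; apply: mem_short_paths; rewrite p1r.
Qed.

End VeroneseIso.

(** Apply [eventually_veronese] to homogeneous elements, with [N'] zero for the kernel and the image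
    of [f] for the cokernel. *)
Lemma veronese_Fdim_iso (M N : grmod k Q) (f : grhom M N) :
  Fdim_iso (veronese_mor f : @hom (Gr k Qm) _ _) -> Fdim_iso (f : @hom (Gr k Q) M N).
Proof.
case/Fdim_isoP => kerT cokT; apply/Fdim_isoP; split=> [x fx0|y].
  elim: (gspan_ker fx0) => [|i y z [Dy fy] _ Tz]; first exact: eventually_in0.
  apply: eventually_inD Tz; first by move=> ? ? -> ->; rewrite addr0.
  apply: (eventually_veronese _ Dy) => [a _ ->|a w ew]; first by rewrite scaler0.
  have [|n nw] := kerT w.
    by apply: vval_inj; rewrite vval_mor ew linearZ_LR fy scaler0.
  by exists n => p /nw ->.
elim/gr_ind: y => [|y z Ty Tz|i y Dy].
- by apply: eventually_in0; exists 0; rewrite linear0.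
- apply: eventually_inD Ty Tz => _ _ [u ->] [v ->]; exists (u + v).
  by rewrite linearD.
- apply: (eventually_veronese _ Dy) => [a _ [u ->]|a w ew].
    by exists (a *: u); rewrite linearZ_LR.
  by have [n nw] := cokT w; exists n => p /nw[u ->]; exists (vval u).
Qed.

End Veronese.

(** * The coinduced module, without its grading *)

Lemma homogM (k : fieldType) (Q : quiver) d e (a b : path_algebra k Q) :
  homogeneous d a -> homogeneous e b -> homogeneous (d + e)%N (a * b).
Proof.
move=> da eb; elim/homog_ind: da => [|c p <-|a1 a2 h1 h2].
- by rewrite mul0r; apply: homog0.
- elim/homog_ind: eb => [|c' p' <-|b1 b2 h1 h2].
  + by rewrite mulr0; apply: homog0.
  + rewrite monoM; case e': pcomp => [r|] /=; last exact: homog0.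
    by rewrite addnC -(plength_pcomp e'); apply: homog_mono.
  + by rewrite mulrDr; apply: homogD.
- by rewrite mulrDl; apply: homogD.
Qed.

Lemma homog1 (k : fieldType) (Q : quiver) : homogeneous 0 (1 : path_algebra k Q).
Proof. by rewrite -kscal1; apply: homog_kscal. Qed.

Section CoinducedModule.
Variables (k : fieldType) (Q : quiver) (m : nat).
Local Notation Qm := (quiver_power Q m).
Local Notation kQ := (path_algebra k Q).
Local Notation kQm := (path_algebra k Qm).
Variable N : lmodType kQm.

(* [Hom_kQm(kQ, N)], on which kQ acts through right multiplication on kQ. *)
Record coind := Coind {
  cfun :> kQ -> N;
  cfunD : forall a b, cfun (a + b) = cfun a + cfun b;
  cfunZ : forall c a, cfun (power_emb c * a) = c *: cfun a
}.

Lemma coind_eq (F G : coind) : F =1 G -> F = G.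
Proof.
case: F G => [F FD FZ] [G GD GZ] /= FG; have {}FG : F = G by apply/funext.
by subst G; congr Coind; apply: Prop_irrelevance.
Qed.

HB.instance Definition _ := gen_eqMixin coind.
HB.instance Definition _ := gen_choiceMixin coind.

Lemma cfun0 (F : coind) : F 0 = 0.
Proof. by apply: (addrI (F 0)); rewrite -cfunD !addr0. Qed.

Definition coind0 : coind.
Proof. by exists (fun=> 0) => [a b|c a]; rewrite ?addr0 ?scaler0. Defined.

Definition coind_add (F G : coind) : coind.
Proof.
exists (fun a => F a + G a) => [a b|c a]; first by rewrite !cfunD addrACA.
by rewrite !cfunZ scalerDr.
Defined.

Definition coind_opp (F : coind) : coind.
Proof.
exists (fun a => - F a) => [a b|c a]; first by rewrite cfunD opprD.
by rewrite cfunZ scalerN.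
Defined.

Definition coind_scale (b : kQ) (F : coind) : coind.
Proof.
exists (fun a => F (a * b)) => [a a'|c a]; first by rewrite mulrDl cfunD.
exact: etrans (congr1 F (esym (mulrA (power_emb c) a b))) (cfunZ F c (a * b)).
Defined.

Lemma coind_addA : associative coind_add.
Proof. by move=> F G H; apply: coind_eq => a; apply: addrA. Qed.
Lemma coind_addC : commutative coind_add.
Proof. by move=> F G; apply: coind_eq => a; apply: addrC. Qed.
Lemma coind_add0 : left_id coind0 coind_add.
Proof. by move=> F; apply: coind_eq => a; apply: add0r. Qed.
Lemma coind_addN : left_inverse coind0 coind_opp coind_add.
Proof. by move=> F; apply: coind_eq => a; apply: addNr. Qed.
HB.instance Definition _ := GRing.isZmodule.Build coind
  coind_addA coind_addC coind_add0 coind_addN.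

Lemma coind_scaleA a b F : coind_scale a (coind_scale b F) = coind_scale (a * b) F.
Proof. by apply: coind_eq => c /=; rewrite mulrA. Qed.
Lemma coind_scale1 : left_id 1 coind_scale.
Proof. by move=> F; apply: coind_eq => c /=; rewrite mulr1. Qed.
Lemma coind_scaleDr : right_distributive coind_scale +%R.
Proof. by move=> a F G; apply: coind_eq. Qed.
Lemma coind_scaleDl F : {morph coind_scale^~ F : a b / a + b}.
Proof. by move=> a b; apply: coind_eq => c /=; rewrite mulrDr cfunD. Qed.
HB.instance Definition _ := GRing.Zmodule_isLmodule.Build kQ coind
  coind_scaleA coind_scale1 coind_scaleDr coind_scaleDl.

Lemma coind_sumE I (s : seq I) (F : I -> coind) a :
  (\sum_(i <- s) F i) a = \sum_(i <- s) F i a.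
Proof. exact: (big_morph (fun G : coind => G a) (fun _ _ => erefl) erefl). Qed.

End CoinducedModule.

(** * The right adjoint G *)

Section Coinduction.
Variables (k : fieldType) (Q : quiver) (m : nat).
Hypothesis m_gt0 : (0 < m)%N.
Local Notation Qm := (quiver_power Q m).
Local Notation kQ := (path_algebra k Q).
Local Notation kQm := (path_algebra k Qm).

(** [F] raises degrees by [i], where degree j of [N] is placed in degree m j and the other degrees
    are empty. *)
Definition coind_deg (N : grmod k Qm) (i : int) (F : coind N) : Prop :=
  forall d a, homogeneous d a ->
    (forall j, d%:Z + i = m%:Z * j -> gdeg j (F a)) /\
    (~~ mdvd m (d%:Z + i) -> F a = 0).

Definition coind_pregrmod (N : grmod k Qm) : pregrmod k Q.
Proof.
apply: (@PreGrMod k Q (coind N) (@coind_deg N)).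
- by move=> i d a da; split=> // j _; apply: (@gdeg0 _ _ N).
- move=> i F G DF DG d a da; have [F1 F2] := DF d a da; have [G1 G2] := DG d a da.
  split=> [j e|nd]; first exact: (@gdegB _ _ N) (F1 j e) (G1 j e).
  by rewrite -[LHS]/(F a - G a) F2 // G2 // subr0.
- move=> d i b F db DF e a ea; have := DF _ _ (homogM ea db).
  by rewrite PoszD -addrA.
- move=> s F us DF F0 i si; apply: coind_eq => a.
  elim/pa_ind: a => [|c p|a b IHa IHb]; last 1 first.
  + by rewrite cfunD IHa IHb -[LHS]/(0 + 0) addr0.
  + exact: cfun0.
  have [F1 F2] := DF i _ _ (homog_mono c p).
  have [/asboolP[j e]|/F2-> //] := boolP (mdvd m ((plength p)%:Z + i)).
  (* Evaluated at [p], the maps [F i'] take values in different degrees of [N], or vanish;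
     projecting onto degree [j] isolates [F i]. *)
  have := gproj_sum (M := N) (pred1 j) s (fun i => F i (mono c p)).
  rewrite -coind_sumE F0 gproj0 (bigD1_seq i) //= (gproj_deg (F1 _ e)) /= ?eqxx //.
  rewrite big1 ?addr0 // => i' ii'; have [F1' F2'] := DF i' _ _ (homog_mono c p).
  have [/asboolP[j' e']|/F2'->] := boolP (mdvd m ((plength p)%:Z + i')); last exact: gproj0.
  apply: (gproj_deg0 (F1' _ e')); apply: contra ii' => /= /eqP ej.
  by apply/eqP/(@addrI _ (plength p)%:Z); rewrite e e' ej.
Defined.

Definition coinduced (N : grmod k Qm) : grmod k Q := grpart_grmod (coind_pregrmod N).

Definition cval (N : grmod k Qm) (x : coinduced N) : coind N := gval x.

Lemma cval_inj (N : grmod k Qm) (x y : coinduced N) : cval x =1 cval y -> x = y.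
Proof. move=> /coind_eq; exact: (@gval_inj _ _ (coind_pregrmod N)). Qed.

Lemma veronese_gdeg (M : grmod k Q) i (x : veronese m_gt0 M) :
  gdeg i x = gdeg (m%:Z * i) (vval x).
Proof. by []. Qed.

Lemma coinduced_gdeg (N : grmod k Qm) i (x : coinduced N) :
  gdeg i x = coind_deg i (cval x).
Proof. by []. Qed.

Section CoinducedMorphism.
Variables (M N : grmod k Qm) (f : grhom M N).

Definition coind_map (F : coind M) : coind N.
Proof.
exists (fun a => f (F a)) => [a b|c a]; first by rewrite cfunD linearD.
by rewrite cfunZ linearZ_LR.
Defined.

Lemma coind_map_linear : linear coind_map.
Proof. by move=> a F G; apply: coind_eq => b; apply: (linearD f). Qed.

Lemma coind_map_deg i F : coind_deg i F -> coind_deg i (coind_map F).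
Proof.
move=> DF d a da; have [F1 F2] := DF d a da; split=> [j /F1|/F2]; first exact: glin_deg.
by move=> /= ->; apply: linear0.
Qed.

Lemma coinduced_mor_subproof (x : coinduced M) :
  gspan (@pdeg k Q (coind_pregrmod N)) (coind_map (cval x)).
Proof.
apply: gspan_map (gvalP x).
- by apply: coind_eq => a; apply: (linear0 f).
- by move=> F G; apply: coind_eq => a; apply: (linearD f).
- by move=> i F DF; apply: (@gspan_in _ _ i); apply: coind_map_deg.
Qed.

Definition coinduced_fun (x : coinduced M) : coinduced N := GrPart (coinduced_mor_subproof x).

Lemma coinduced_linear : linear coinduced_fun.
Proof. by move=> a x y; apply: gval_inj; apply: coind_map_linear. Qed.

Definition coinduced_mor : grhom (coinduced M) (coinduced N) :=
  @GrHom k Q (coinduced M) (coinduced N) (linear_of coinduced_linear)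
    (fun i x => @coind_map_deg i (cval x)).

End CoinducedMorphism.

Definition coinduced_functor : functor (Gr k Qm) (Gr k Q).
Proof.
apply: (@Functor (Gr k Qm) (Gr k Q) coinduced coinduced_mor).
- by move=> M N f g fg x; apply: cval_inj => a; apply: fg.
- by move=> M x; apply: cval_inj.
- by move=> M N P g f x; apply: cval_inj.
Defined.

(** * The counit and its inverse *)

Section Counit.
Variable N : grmod k Qm.
Local Notation VGN := (veronese m_gt0 (coinduced N)).

Definition counit_fun (x : VGN) : N := cval (vval x) 1.

Lemma counit_linear : linear counit_fun.
Proof.
move=> a x y; rewrite /counit_fun vvalD vvalZ -[LHS]/(cval (vval x) (1 * _) + cval (vval y) 1).
by rewrite mul1r -[power_emb a]mulr1 cfunZ.
Qed.

Lemma counit_deg i (x : VGN) : gdeg i x -> gdeg i (counit_fun x).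
Proof.
rewrite veronese_gdeg coinduced_gdeg => DF.
have [F1 _] := DF 0%N 1 (@homog1 k Q).
have e : 0%:Z + m%:Z * i = m%:Z * i by rewrite add0r.
exact: (F1 i e).
Qed.

Definition counit : grhom VGN N :=
  @GrHom k Qm VGN N (linear_of counit_linear) counit_deg.

Definition cofree (n : N) : coind N.
Proof.
exists (fun a => power_proj m a *: n) => [a b|c a]; first by rewrite power_projD scalerDl.
by rewrite power_proj_emb // scalerA.
Defined.

Lemma cofreeD n n' : cofree (n + n') = cofree n + cofree n'.
Proof. by apply: coind_eq => a; apply: scalerDr. Qed.

Lemma cofree0 : cofree 0 = 0.
Proof. by apply: coind_eq => a; apply: scaler0. Qed.

(** psi kills the degrees that m does not divide and divides the others by m. *)
Lemma cofree_deg i n : gdeg i n -> coind_deg (m%:Z * i) (cofree n).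
Proof.
move=> Dn d a da; have [/dvdnP[e ed]|nd] := boolP (m %| d)%N; last first.
  by rewrite /= (power_proj_ndvd nd da) scale0r; split=> // j _; apply: (@gdeg0 _ _ N).
rewrite mulnC in ed; rewrite ed in da *; split=> [j|]; last first.
  by rewrite PoszM -mulrDr mdvdM.
rewrite PoszM -mulrDr => /(mulz_inj m_gt0) <-.
exact: gdegZ (homog_power_proj m_gt0 da) Dn.
Qed.

Lemma gspan_cofree n : gspan (@pdeg k Q (coind_pregrmod N)) (cofree n).
Proof.
apply: gspan_map (gr_span n); [exact: cofree0 | exact: cofreeD |].
by move=> i x Dx; apply: (@gspan_in _ _ (m%:Z * i)); apply: cofree_deg.
Qed.

Definition to_coinduced n : coinduced N := GrPart (gspan_cofree n).

Lemma gspan_to_coinduced n :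
  gspan (@pdeg k Qm (veronese_pregrmod m_gt0 (coinduced N))) (to_coinduced n).
Proof.
apply: gspan_map (gr_span n).
- by apply: gval_inj; apply: cofree0.
- by move=> x y; apply: gval_inj; apply: cofreeD.
- by move=> i x Dx; apply: (@gspan_in _ _ i); apply: cofree_deg.
Qed.

Definition counit_inv_fun n : VGN := GrPart (gspan_to_coinduced n).

Lemma cval_counit_inv n a : cval (vval (counit_inv_fun n)) a = power_proj m a *: n.
Proof. by []. Qed.

Lemma counit_inv_funK : cancel counit_inv_fun counit_fun.
Proof.
move=> n; rewrite [LHS]cval_counit_inv.
by rewrite -(power_emb1 k Q m) power_embK // scale1r.
Qed.

(** A map [F] of degree m i kills every component of kQ whose degree is not divisible by m, since
    its value there would lie in an empty degree. Hence F(a) = F(phi(psi(a))) = psi(a) F(1). *)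
Lemma counit_funK : cancel counit_fun counit_inv_fun.
Proof.
have funD x y : counit_fun (x + y) = counit_fun x + counit_fun y.
  exact: (linearD counit).
have fun0 : counit_fun 0 = 0 by exact: (linear0 counit).
have invD x y : counit_inv_fun (x + y) = counit_inv_fun x + counit_inv_fun y.
  by apply: vval_inj; apply: gval_inj; apply: cofreeD.
have inv0 : counit_inv_fun 0 = 0.
  by apply: vval_inj; apply: gval_inj; apply: cofree0.
elim/gr_ind => [|x y IHx IHy|i x Dx]; first by rewrite fun0 inv0.
  by rewrite funD invD IHx IHy.
apply: vval_inj; apply: cval_inj => a.
rewrite cval_counit_inv -cfunZ mulr1.
elim/pa_ind: a => [|c p|a b IHa IHb]; last 1 first.
- by rewrite power_projD power_embD !cfunD IHa IHb.
- by rewrite power_proj0 power_emb0.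
have Dp := homog_mono c p.
have [/dvdnP[e ed]|nd] := boolP (m %| plength p)%N.
  by rewrite mulnC in ed; rewrite ed in Dp; rewrite (power_projK m_gt0 Dp).
rewrite (power_proj_ndvd nd Dp) power_emb0 cfun0.
rewrite veronese_gdeg coinduced_gdeg in Dx.
have [_ -> //] := Dx _ _ Dp; apply: contra nd => /asboolP[j e].
suff : (m%:Z %| (plength p)%:Z)%Z by [].
by apply/dvdzP; exists (j - i); rewrite mulrBl -![_ * m%:Z]mulrC -e addrK.
Qed.

Lemma counit_inv_linear : linear counit_inv_fun.
Proof.
move=> a x y; apply: (can_inj counit_funK).
by rewrite [RHS]counit_linear !counit_inv_funK.
Qed.

Definition counit_inv : grhom N VGN.
Proof.
apply: (@GrHom k Qm N VGN (linear_of counit_inv_linear)) => i n Dn.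
by rewrite veronese_gdeg coinduced_gdeg; apply: cofree_deg Dn.
Defined.

Lemma counit_inj : injective counit.
Proof. exact: (can_inj counit_funK). Qed.

Lemma counit_surj n : exists x, n = counit x.
Proof. by exists (counit_inv_fun n); rewrite -[RHS]/(counit_fun _) counit_inv_funK. Qed.

End Counit.

Lemma counit_natural (M N : grmod k Qm) (f : grhom M N) x :
  counit N (veronese_mor m_gt0 (coinduced_mor f) x) = f (counit M x).
Proof. by []. Qed.

Definition counit_iso :
  nat_iso (comp_functor (veronese_functor k Q m_gt0) coinduced_functor) (id_functor _).
Proof.
apply: (@NatIso _ _ (comp_functor (veronese_functor k Q m_gt0) coinduced_functor)
  (id_functor (Gr k Qm)) counit counit_inv).
- by move=> N; split; [exact: counit_funK | exact: counit_inv_funK].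
- by move=> M N f x; apply: counit_natural.
Defined.

(** V reflects the inverted morphisms, and V G f is conjugate to [f] through the counit, so the
    bounds for [f] apply unchanged. *)
Lemma coinduced_Fdim_iso (M N : grmod k Qm) (f : grhom M N) :
  Fdim_iso (f : @hom (Gr k Qm) M N) -> Fdim_iso (coinduced_mor f : @hom (Gr k Q) _ _).
Proof.
case/Fdim_isoP => kerT cokT; apply: (veronese_Fdim_iso (m_gt0 := m_gt0)).
apply/Fdim_isoP; split=> [x fx0|y].
  have [|n nx] := kerT (counit M x).
    by rewrite -counit_natural fx0 linear0.
  exists n => p /nx px; apply: counit_inj; rewrite linearZ_LR linear0.
  exact: px.
have [n ny] := cokT (counit N y); exists n => p /ny[u eu].
have [x ex] := counit_surj u; exists x; apply: counit_inj.
by rewrite counit_natural -ex linearZ_LR.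
Qed.

(** * The unit *)

Section Unit.
Variable M : grmod k Q.
Local Notation VM := (veronese m_gt0 M).
Local Notation GVM := (coinduced VM).

Definition unit_coind (x : M) : coind VM.
Proof.
exists (fun a => vproj m_gt0 (a *: x)) => [a b|c a]; first by rewrite scalerDl vprojD.
by rewrite -scalerA vprojZ.
Defined.

Lemma unit_coind_linear : linear unit_coind.
Proof.
move=> b x y; apply: coind_eq => a.
rewrite -[RHS]/(vproj m_gt0 ((a * b) *: x) + vproj m_gt0 (a *: y)) /=.
by rewrite scalerDr vprojD scalerA.
Qed.

Lemma unit_coind_deg i x : gdeg i x -> coind_deg i (unit_coind x).
Proof.
move=> Dx d a da; have Dax := gdegZ da Dx; split=> [j e|nd].
  rewrite e in Dax; rewrite -[gdeg _ _]/(gdeg (m%:Z * j) (gproj (mdvd m) (a *: x))).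
  by rewrite (gproj_deg Dax) // mdvdM.
by apply: vval_inj; apply: (gproj_deg0 Dax).
Qed.

Lemma gspan_unit x : gspan (@pdeg k Q (coind_pregrmod VM)) (unit_coind x).
Proof.
apply: gspan_map (gr_span x).
- by apply: coind_eq => a; apply: vval_inj; rewrite vval_proj scaler0 gproj0.
- by move=> x' y; rewrite -[x']scale1r unit_coind_linear !scale1r.
- by move=> i y Dy; apply: (@gspan_in _ _ i); apply: unit_coind_deg.
Qed.

Definition unit_fun x : GVM := GrPart (gspan_unit x).

Lemma unit_linear : linear unit_fun.
Proof. by move=> a x y; apply: gval_inj; apply: unit_coind_linear. Qed.

Definition coind_unit : grhom M GVM :=
  @GrHom k Q M GVM (linear_of unit_linear) unit_coind_deg.

(** A triangle identity: the map attached to [x], evaluated at 1, is the projection of [x], which is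
    [x] itself. *)
Lemma counit_unit (x : VM) : counit VM (veronese_mor m_gt0 coind_unit x) = x.
Proof.
rewrite -[LHS]/(vproj m_gt0 (1 *: vval x)) scale1r.
exact: vvalK.
Qed.

(** V of the unit is bijective, being a section of the injective counit, so it is inverted; V
    reflects this. *)
Lemma coind_unit_Fdim_iso : Fdim_iso (coind_unit : @hom (Gr k Q) _ _).
Proof.
apply: (veronese_Fdim_iso (m_gt0 := m_gt0)); apply/Fdim_isoP; split=> [x ux0|y].
  rewrite -(counit_unit x) ux0 linear0; exact: eventually_in0.
(* Every element has a preimage under V of the unit, namely its image under the counit, so the bound
   0 works. *)
exists 0%N => p _; set z := mono 1 p *: y; exists (counit VM z).
by apply: counit_inj; rewrite counit_unit.
Qed.

End Unit.

Lemma coind_unit_natural (M N : grmod k Q) (f : grhom M N) x :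
  coind_unit N (f x) = coinduced_mor (veronese_mor m_gt0 f) (coind_unit M x).
Proof.
apply: cval_inj => a; apply: vval_inj.
rewrite -[LHS]/(gproj (mdvd m) (a *: f x)) -linearZ_LR.
exact: gproj_grhom.
Qed.

End Coinduction.

Theorem theorem1p8 (k : fieldType) (Q : quiver) (m : nat) (m_ge1 : (1 <= m)%N) :
  equivalent_categories (QGr k Q) (QGr k (quiver_power Q m)).
Proof.
apply: (@localized_equivalence (Gr k Q) (Gr k (quiver_power Q m))
  (@Fdim_iso k Q) (@Fdim_iso k (quiver_power Q m))
  (veronese_functor k Q m_ge1) (coinduced_functor k Q m)
  (fun M N f => @Fdim_iso_veronese k Q m m_ge1 M N f)
  (fun M N f => @coinduced_Fdim_iso k Q m m_ge1 M N f)
  (coind_unit m_ge1)).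
- by move=> M N f x; apply: coind_unit_natural.
- exact: coind_unit_Fdim_iso.
- exact: counit_iso.
Qed.
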